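(* Consider line arrangements $\mathcal A$ in $\mathbb P^2$ with $d=|\mathcal A|\ge 2$ lines, having $n_2$ double points, $n_3$ triple points and no points of higher multiplicity. The invariant $r(\mathcal A)$ is determined by the combinatorics of $\mathcal A$ if and only if $n_3\le 5$. That is, for an integer $n_3\ge 0$, the following are equivalent: (i) any two such line arrangements $\mathcal A_1,\mathcal A_2$, both with exactly $n_3$ triple points and with isomorphic intersection lattices $L(\mathcal A_1)\cong L(\mathcal A_2)$, satisfy $r(\mathcal A_1)=r(\mathcal A_2)$; (ii) $n_3\le 5$.
   Context: $\mathbb K$ is a field of characteristic zero, $S=\mathbb K[x,y,z]$ with the standard grading. A line arrangement $\mathcal A$ in $\mathbb P^2$ is a finite set of distinct lines, given by $f=0$ with $f\in S$ a product of pairwise non-proportional linear forms. $r(\mathcal A)$ is the minimal degree $r$ for which there is a nonzero triple $(a,b,c)\in S_r^3$ with $af_x+bf_y+cf_z=0$. Double (triple) points are the points lying on exactly $2$ (exactly $3$) lines of $\mathcal A$. The combinatorics of $\mathcal A$ is its intersection lattice $L(\mathcal A)$. *)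

(* Defs.v *)
From HB Require Import structures.
From mathcomp Require Import all_boot all_order all_algebra.
From mathcomp Require Import boolp.
From mathcomp Require Import mpoly.

Set Implicit Arguments.
Unset Strict Implicit.
Unset Printing Implicit Defensive.

Import GRing.Theory.

Local Open Scope ring_scope.

(* S = K[x, y, z] is {mpoly K[3]}, with x, y, z the variables of index 0, 1, 2.
   Points and lines of the projective plane are the 1- and 2-dimensional
   subspaces of K^3 = 'rV[K]_3, incidence being inclusion. *)

Record line_arrangement (K : fieldType) := LineArrangement {
  nlines : nat;
  form : 'I_nlines -> {mpoly K[3]};
  form_linear : forall i, form i \is 1.-homog;
  form_neq0 : forall i, form i != 0;
  form_nonprop : forall i j, i != j -> forall c : K, form i != c *: form j
}.

Section Arrangements.

Variable K : fieldType.

Definition zero_line (l : {mpoly K[3]}) : {vspace 'rV[K]_3} :=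
  lker (linfun (fun v : 'rV[K]_3 => l.@[v 0] : K^o)).

(* linfun is only meaningful on linear maps, whence the homogeneity. *)
Lemma mem_zero_line (l : {mpoly K[3]}) (v : 'rV[K]_3) :
  l \is 1.-homog -> (v \in zero_line l) = (l.@[v 0] == 0).
Proof.
move=> hl.
have lin : linear (fun v : 'rV[K]_3 => l.@[v 0] : K^o).
  move=> c u w; rewrite !mevalE scaler_sumr -big_split /=.
  rewrite !big_seq; apply: eq_bigr => m /(dhomog_mf hl) /eqP /mdeg1P[i /eqP ->].
  have e (t : 'rV[K]_3) : \prod_(j < 3) t 0 j ^+ U_(i)%MM j = t 0 i.
    rewrite (bigD1 i) //= mnm1E eqxx expr1 big1 ?mulr1 // => j /negPf ji.
    by rewrite mnm1E eq_sym ji expr0.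
  by rewrite !e !mxE mulrDr [c *: _]/(c * _) mulrCA.
pose g := GRing.isLinear.Build _ _ _ _ _ lin.
pose h : {linear 'rV[K]_3 -> K^o} := HB.pack (fun v : 'rV[K]_3 => l.@[v 0] : K^o) g.
by rewrite memv_ker (lfunE h).
Qed.

Variable A : line_arrangement K.

Definition line (i : 'I_(nlines A)) : {vspace 'rV[K]_3} := zero_line (form i).

Definition defining_poly : {mpoly K[3]} := \prod_(i < nlines A) form i.

(* Number of lines of A through p. *)
Definition mult (p : {vspace 'rV[K]_3}) : nat :=
  #|[set i : 'I_(nlines A) | (p <= line i)%VS]|.

Definition has_npoints (k n : nat) : Prop :=
  exists s : seq {vspace 'rV[K]_3},
    [/\ uniq s, size s = n &
        forall p, (p \in s) = (\dim p == 1%N) && (mult p == k)].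

Definition only_double_triple_points : Prop :=
  forall p : {vspace 'rV[K]_3}, \dim p = 1%N -> (mult p <= 3)%N.

(* All intersections of lines of A, the empty one being the whole space;
   undup because distinct families of lines may have the same intersection. *)
Definition flats : seq {vspace 'rV[K]_3} :=
  undup [seq (\bigcap_(i in B) line i)%VS | B : {set 'I_(nlines A)}].

Definition intersection_lattice : finType := seq_sub flats.

Definition flat_le (X Y : intersection_lattice) : bool :=
  (ssval Y <= ssval X)%VS.

End Arrangements.

Definition lattice_isomorphic (K : fieldType) (A1 A2 : line_arrangement K) :
    Prop :=
  exists2 phi : intersection_lattice A1 -> intersection_lattice A2,
    bijective phi & {mono phi : X Y / flat_le X Y}.

Section MinimalSyzygyDegree.

Variable K : fieldType.

Definition jacobian_syzygy (f : {mpoly K[3]}) (r : nat) : Prop :=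
  exists a : 'I_3 -> {mpoly K[3]},
    [/\ forall j, a j \is r.-homog,
        exists j, a j != 0 &
        \sum_(j < 3) a j * f^`M(j) = 0].

Lemma mderiv_homog (f : {mpoly K[3]}) (d : nat) (i : 'I_3) :
  f \is d.-homog -> f^`M(i) \is d.-1.-homog.
Proof.
move=> hf; rewrite [f]mpolyE raddf_sum /= big_seq.
apply: rpred_sum => m /(dhomog_mf hf) /= md.
rewrite mderivZ mderivX; apply: rpredZ.
case: (posnP (m i)) => [->|mi]; first by rewrite scale0r rpred0.
apply: rpredZ; rewrite dhomogX /=.
have le : (U_(i) <= m)%MM.
  by apply/mnm_lepP => j; rewrite mnm1E; case: eqP => // <-.
by rewrite -md -{2}(submK le) mdegD mdeg1 addn1.
Qed.

Lemma defining_poly_homog (A : line_arrangement K) :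
  defining_poly A \is (nlines A).-homog.
Proof.
rewrite /defining_poly -[X in X.-homog]card_ord -sum1_card.
elim/big_ind2: _ => [|p d q e hp hq|i _]; [exact: dhomog1|exact: dhomogM|].
exact: form_linear.
Qed.

(* Koszul syzygies. *)
Lemma jacobian_syzygy_exists (A : line_arrangement K) :
  exists r, `[< jacobian_syzygy (defining_poly A) r >].
Proof.
set f := defining_poly A; have hf i := mderiv_homog i (defining_poly_homog A).
pose i0 : 'I_3 := 0; pose i1 : 'I_3 := 1.
have [f0|f0] := eqVneq f^`M(i0) 0.
  exists 0%N; apply/asboolP; exists (fun j => (j == i0)%:R); split.
  - by move=> j; case: (j == i0); rewrite ?dhomog1 ?rpred0.
  - by exists i0; rewrite eqxx oner_eq0.
  rewrite (bigD1 i0) //= f0 mulr0 add0r big1 // => j /negPf ->.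
  by rewrite mul0r.
exists (nlines A).-1; apply/asboolP.
exists (fun j => if j == i0 then f^`M(i1) else
                 if j == i1 then - f^`M(i0) else 0); split.
- move=> j; case: ifP => _; first exact: hf.
  by case: ifP => _; rewrite ?rpred0 // rpredN hf.
- by exists i1; rewrite oppr_eq0.
rewrite (bigD1 i0) // (bigD1 i1) //= big1 => [|j /andP[/negPf -> /negPf ->]].
  by rewrite addr0 mulNr mulrC subrr.
by rewrite mul0r.
Qed.

Definition mdr (A : line_arrangement K) : nat :=
  ex_minn (jacobian_syzygy_exists A).

End MinimalSyzygyDegree.

(* Main.v *)
Require Import Defs.
From HB Require Import structures.
From mathcomp Require Import all_boot all_order all_algebra.
From mathcomp Require Import boolp.
From mathcomp Require Import mpoly.
From mathcomp Require Import ring zify.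

Set Implicit Arguments.
Unset Strict Implicit.
Unset Printing Implicit Defensive.

Import GRing.Theory.

Local Open Scope ring_scope.

(** Syzygies as forms. Lines of the projective plane are planes through the origin
    of K^3, given by normal vectors a_i; f is the product of the d linear forms
    a_i . X, and r is the least degree of a syzygy. A syzygy of degree k is a
    vector field theta killing f; it is tangent to all the planes, and modulo the
    radial field it is recorded by the cross product w = X x theta, of degree
    k + 1, which satisfies X . w = 0 and is normal to each plane along that plane. Conversely such a w gives back the syzygy
    (w x grad f) / f, so that r + 1 is the least degree of a nonzero w
    ([log_form_of_syzygy], [syzygy_of_log_form], [mdr_leP]). The product of w by
    the equation of one more plane is logarithmic for the larger family.

    Removing a line. On a plane H the form w is normal to H, and it vanishes
    where H meets another plane. If H contains t triple points these
    are d - 1 - t lines, so when deg w < d - 1 - t the form w vanishes on H and can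
    be divided by its equation ([log_form_delete]). Hence removing a line with at
    most one triple point on it preserves d - r as long as triple points remain.

    At most five triple points. Call a subfamily a core if each of its lines
    contains at least two of its triple points. Removing lines one at a time gives
    d - r <= 2, 3 or 4, according to whether there is no triple point, there are
    some but no core, or there is a core ([log_form_degree_ge]). These bounds are
    attained: with two lines, with three concurrent ones, and, for a core, because
    a family of d >= 5 lines with at least d - 2 triple points has a syzygy of
    degree d - 4 by counting parameters ([core_log_form]), while double counting
    shows that a core with n <= 5 triple points has at most n + 2 lines
    ([core_card]). Since the
    intersection lattice determines which triples of lines are concurrent
    ([lattice_isomorphic_lines]), it determines r ([mdr_combinatorial]).

    Six triple points or more. Take six points e_0, e_1, e_2, Q_0, Q_1, Q_2 and the
    nine lines e_s Q_r. When the six points lie on a conic there is a form w of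
    degree 6, written down in [conic_form]. In general there is none: at a triple
    point the derivative of w is governed by a single scalar, along each line the
    scalars at its two triple points determine each other, and going around the
    quadrilateral e_0 Q_0 e_1 Q_1 forces these scalars to be zero
    ([triple_point_derivative], [edge_relation], [hex_no_form]). So two such
    arrangements have the same lattice and r = 5 or r = 6. Adding to both a general
    line through corresponding double points creates one triple point and preserves
    d - r, which gives a pair for each larger number of triple points
    ([lattice_twinsS]). *)

(** * Vector algebra in dimension three *)

Section Vectors.

Variable R : comNzRingType.
Implicit Types (a b c u v w : 'rV[R]_3) (x y : R).

Definition dot u v : R := \sum_j u 0 j * v 0 j.

(** The indices j + 1 and j + 2 are taken modulo 3. *)
Definition cross u v : 'rV[R]_3 :=
  \row_j (u 0 (j + 1) * v 0 (j + 2) - u 0 (j + 2) * v 0 (j + 1)).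

Definition det3 u v w : R := dot (cross u v) w.

Lemma sum3E (V : nmodType) (F : 'I_3 -> V) : \sum_j F j = F 0 + F 1 + F 2.
Proof.
rewrite !big_ord_recr big_ord0 /= add0r.
by congr (F _ + F _ + F _); apply: val_inj.
Qed.

Lemma ord3P (P : 'I_3 -> Prop) : P 0 -> P 1 -> P 2 -> forall j, P j.
Proof.
move=> h0 h1 h2 [[|[|[|//]]] h]; first by congr P: h0; apply: val_inj.
- by congr P: h1; apply: val_inj.
- by congr P: h2; apply: val_inj.
Qed.

Lemma row3P u v :
  u 0 0 = v 0 0 -> u 0 1 = v 0 1 -> u 0 2 = v 0 2 -> u = v.
Proof. by move=> h0 h1 h2; apply/rowP; apply: ord3P. Qed.

Lemma dotE u v : dot u v = u 0 0 * v 0 0 + u 0 1 * v 0 1 + u 0 2 * v 0 2.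
Proof. exact: sum3E. Qed.

Lemma crossE u v :
  (cross u v 0 0 = u 0 1 * v 0 2 - u 0 2 * v 0 1) *
  (cross u v 0 1 = u 0 2 * v 0 0 - u 0 0 * v 0 2) *
  (cross u v 0 2 = u 0 0 * v 0 1 - u 0 1 * v 0 0).
Proof.
by do !split; rewrite mxE; congr (u 0 _ * v 0 _ - u 0 _ * v 0 _); apply: val_inj.
Qed.


End Vectors.

Ltac vector_ring :=
  rewrite /det3; first [apply: row3P | idtac];
  rewrite ?(dotE, crossE, mxE); ring.

Section VectorIdentities.

Variable R : comNzRingType.
Implicit Types (a b c u v w : 'rV[R]_3) (x y : R).

Lemma dotC u v : dot u v = dot v u.
Proof. vector_ring. Qed.

Lemma dotDr u v w : dot u (v + w) = dot u v + dot u w.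
Proof. vector_ring. Qed.

Lemma dotZr x u v : dot u (x *: v) = x * dot u v.
Proof. vector_ring. Qed.

Lemma dotDl u v w : dot (u + v) w = dot u w + dot v w.
Proof. vector_ring. Qed.

Lemma dotZl x u v : dot (x *: u) v = x * dot u v.
Proof. vector_ring. Qed.

Lemma dot0r u : dot u 0 = 0.
Proof. vector_ring. Qed.

Lemma dotNr u v : dot u (- v) = - dot u v.
Proof. vector_ring. Qed.

Lemma crossC u v : cross u v = - cross v u.
Proof. vector_ring. Qed.

Lemma cross0r u : cross u 0 = 0.
Proof. vector_ring. Qed.

Lemma cross0l u : cross 0 u = 0.
Proof. vector_ring. Qed.

Lemma cross_self u : cross u u = 0.
Proof. vector_ring. Qed.

Lemma crossDr u v w : cross u (v + w) = cross u v + cross u w.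
Proof. vector_ring. Qed.

Lemma crossZr x u v : cross u (x *: v) = x *: cross u v.
Proof. vector_ring. Qed.

Lemma crossZl x u v : cross (x *: u) v = x *: cross u v.
Proof. vector_ring. Qed.

Lemma dot_crossl u v : dot u (cross u v) = 0.
Proof. vector_ring. Qed.

Lemma dot_crossr u v : dot v (cross u v) = 0.
Proof. vector_ring. Qed.

Lemma double_cross u v w :
  cross (cross u v) w = dot u w *: v - dot v w *: u.
Proof. vector_ring. Qed.

Lemma det3_cycle u v w : det3 u v w = det3 v w u.
Proof. vector_ring. Qed.

Lemma det3C u v w : det3 u v w = - det3 v u w.
Proof. vector_ring. Qed.

Lemma det3_dot u v w : dot u (cross v w) = det3 u v w.
Proof. vector_ring. Qed.

Lemma det3uu u w : det3 u u w = 0.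
Proof. vector_ring. Qed.

Lemma cramer3 a u v w :
  det3 u v w *: a = det3 a v w *: u + det3 u a w *: v + det3 u v a *: w.
Proof. vector_ring. Qed.

Lemma cramer3_dual a u v w :
  det3 u v w *: a
  = dot u a *: cross v w + dot v a *: cross w u + dot w a *: cross u v.
Proof. vector_ring. Qed.

End VectorIdentities.

Section FieldVectors.

Variable K : fieldType.
Implicit Types (a b c u v w : 'rV[K]_3).

Lemma rV3_neq0 u : u != 0 -> exists j, u 0 j != 0.
Proof.
move=> u0; apply/existsP; apply: contraNT u0; rewrite negb_exists => /forallP h.
by apply/eqP/rowP => j; rewrite mxE; apply/eqP; rewrite -[_ == _]negbK.
Qed.

Lemma cross_eq0_coord u v i l : cross u v = 0 -> u 0 i * v 0 l = u 0 l * v 0 i.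
Proof.
move=> uv; have z k : cross u v 0 k = 0 by rewrite uv mxE.
move: (z 0) (z 1) (z 2); rewrite !crossE => /subr0_eq h0 /subr0_eq h1 /subr0_eq h2.
by move: i; apply: ord3P; move: l; apply: ord3P.
Qed.

Lemma cross_eq0P u v : u != 0 -> cross u v = 0 -> exists x, v = x *: u.
Proof.
move=> /rV3_neq0[j uj] uv; exists (v 0 j / u 0 j).
apply/rowP => i; rewrite mxE; apply: (mulfI uj).
by rewrite (cross_eq0_coord j i uv) mulrC -!mulrA [X in _ = _ * X]mulrCA mulVKf // mulrC.
Qed.

Lemma dot_eq0 u : (forall v, dot u v = 0) -> u = 0.
Proof.
move=> h; apply/rowP => j; rewrite mxE -(h (delta_mx 0 j)) /dot (bigD1 j) //=.
rewrite big1 => [|i ij]; first by rewrite mxE !eqxx mulr1 addr0.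
by rewrite mxE eqxx (negPf ij) mulr0.
Qed.

Lemma exists_dot1 a : a != 0 -> exists n, dot a n = 1.
Proof.
move=> /rV3_neq0[j aj]; exists ((a 0 j)^-1 *: delta_mx 0 j).
rewrite dotZr /dot (bigD1 j) //= big1 => [|i ij].
  by rewrite mxE !eqxx mulr1 addr0 mulVf.
by rewrite mxE eqxx (negPf ij) mulr0.
Qed.

Lemma dot2_eq0P a b v :
  cross a b != 0 -> dot a v = 0 -> dot b v = 0 -> exists x, v = x *: cross a b.
Proof.
move=> ab av bv; apply: cross_eq0P => //.
by rewrite double_cross av bv !scale0r subr0.
Qed.

Lemma dot3_eq0 a b c v :
  det3 a b c != 0 -> dot a v = 0 -> dot b v = 0 -> dot c v = 0 -> v = 0.
Proof.
move=> abc av bv cv; apply/(scalerI abc).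
by rewrite cramer3_dual av bv cv !scale0r !addr0 scaler0.
Qed.

Lemma det3_eq0P a b c :
  cross a b != 0 -> det3 a b c = 0 -> exists x y, c = x *: a + y *: b.
Proof.
move=> ab abc; have [n abn] := exists_dot1 ab.
have := cramer3 c a b n; rewrite [det3 a b n]abn abc scale0r addr0 scale1r => ->.
by exists (det3 c b n), (det3 a c n).
Qed.

Lemma det3_eq0_dot a b c v :
  cross a b != 0 -> det3 a b c = 0 -> dot a v = 0 -> dot b v = 0 -> dot c v = 0.
Proof.
move=> ab abc av bv; have [x [y ->]] := det3_eq0P ab abc.
by rewrite dotDl !dotZl av bv !mulr0 addr0.
Qed.

Lemma cross_neq0_neq0 a b : cross a b != 0 -> (a != 0) * (b != 0).
Proof.
by move=> h; split; apply: contraNneq h => ->; rewrite ?cross0l ?cross0r.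
Qed.

End FieldVectors.

(** * Polynomial functions on the space and on a plane *)

Section Polynomials.

Variable K : fieldType.
Hypothesis charK : [pchar K] =i pred0.
Implicit Types (p q : {mpoly K[3]}) (a b f g n u v w : 'rV[K]_3).

Definition linform a : {mpoly K[3]} := \sum_j a 0 j *: 'X_j.

Lemma meval_linform a v : (linform a).@[v 0] = dot a v.
Proof.
rewrite /linform raddf_sum /=; apply: eq_bigr => j _.
by rewrite mevalZ mevalXU.
Qed.

Lemma linform_homog a : linform a \is 1.-homog.
Proof. by apply: rpred_sum => j _; rewrite rpredZ // dhomogX /= mdeg1. Qed.

Lemma mcoeff_linform a j : (linform a)@_U_(j) = a 0 j.
Proof.
rewrite /linform raddf_sum /= (bigD1 j) //= big1 => [|i ij].
  by rewrite mcoeffZ mcoeffXU eqxx mulr1 addr0.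
by rewrite mcoeffZ mcoeffXU (negPf ij) mulr0.
Qed.

Lemma linform_eq0 a : (linform a == 0) = (a == 0).
Proof.
apply/eqP/eqP => [h|->]; last first.
  by rewrite /linform big1 // => j _; rewrite mxE scale0r.
by apply/rowP => j; rewrite -mcoeff_linform h mcoeff0 mxE.
Qed.

Lemma mderiv_linform a j : (linform a)^`M(j) = (a 0 j)%:MP.
Proof.
rewrite /linform raddf_sum /= (bigD1 j) //= big1 => [|i ij].
  rewrite mderivZ mderivX mnm1E eqxx scale1r.
  have -> : (U_(j) - U_(j) = 0 :> 'X_{1..3})%MM.
    by apply/mnmP => i; rewrite mnmBE subnn mnm0E.
  by rewrite mpolyX0 addr0 -mul_mpolyC mulr1.
by rewrite mderivZ mderivX mnm1E (negPf ij) scale0r scaler0.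
Qed.

Lemma natr_neq0 k : (k.+1%:R : K) != 0.
Proof. by rewrite ((pcharf0P K).1 charK). Qed.

Lemma natr_inj : injective (fun k : nat => k%:R : K).
Proof.
have le x y : (x <= y)%N -> x%:R = y%:R :> K -> x = y.
  move=> xy /eqP; rewrite eq_sym -subr_eq0 -natrB // ((pcharf0P K).1 charK) //.
  by rewrite subn_eq0 => yx; apply/eqP; rewrite eqn_leq xy.
move=> x y; case: (leqP x y) => [xy|/ltnW yx] h; first exact: le.
by apply/esym/le.
Qed.

Lemma poly_vanish_eq0 (r : {poly K}) : (forall x, r.[x] = 0) -> r = 0.
Proof.
move=> h; apply/eqP; apply: contraT => r0.
pose s := [seq k%:R : K | k <- iota 0 (size r)].
have := @max_poly_roots _ r s r0.
rewrite size_map size_iota ltnn => -> //.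
- by apply/allP => x _; rewrite /root h.
- by rewrite map_inj_uniq ?iota_uniq //; apply: natr_inj.
Qed.

(** Kronecker's substitution of the powers T, T^N, T^(N^2) for the variables
    keeps distinct monomials distinct once N exceeds the degree, and a polynomial
    in one variable has finitely many roots. *)
Lemma mpoly_vanish_eq0 p : (forall v, p.@[v 0] = 0) -> p = 0.
Proof.
move=> h; pose N := (msize p).+1.
pose e (m : 'X_{1..3}) := ((m 2%R * N + m 1%R) * N + m 0%R)%N.
pose r : {poly K} := \sum_(m <- msupp p) p@_m *: 'X^(e m).
have r0 : r = 0.
  apply: poly_vanish_eq0 => x.
  rewrite -(h (\row_j x ^+ (N ^ j))) mevalE horner_sum.
  apply: eq_bigr => m _; rewrite hornerZ hornerXn; congr (_ * _).
  rewrite !big_ord_recr big_ord0 /= mul1r !mxE -!exprM -!exprD; congr (_ ^+ _).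
  rewrite /e mulnDl -mulnA mulnn expn0 expn1 mul1n addnC [(N ^ 2 * _)%N]mulnC.
  have -> : widen_ord (leqnSn 2) (widen_ord (leqnSn 1) ord_max) = 0 :> 'I_3.
    exact: val_inj.
  have -> : widen_ord (leqnSn 2) ord_max = 1 :> 'I_3 by apply: val_inj.
  have -> : ord_max = 2 :> 'I_3 by apply: val_inj.
  by lia.
have mlt (m : 'X_{1..3}) j : m \in msupp p -> (m j < N)%N.
  move=> /msize_mdeg_lt lt; rewrite ltnS; apply/ltnW/(leq_trans _ lt).
  by rewrite ltnS mdegE (bigD1 j) //= leq_addr.
have einj : {in msupp p &, injective e}.
  move=> m m' mp mp' ee.
  have dig (q1 q2 r1 r2 : nat) : (q1 * N + r1 = q2 * N + r2)%N ->
      (r1 < N)%N -> (r2 < N)%N -> (q1 = q2) * (r1 = r2).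
    move=> eqr l1 l2; have e1 := congr1 (modn^~ N) eqr.
    have e2 := congr1 (divn^~ N) eqr; move: e1 e2.
    by rewrite /= !modnMDl !divnMDl // !modn_small // !divn_small // !addn0.
  have [ee1 m0] := dig _ _ _ _ ee (mlt _ _ mp) (mlt _ _ mp').
  have [m2 m1] := dig _ _ _ _ ee1 (mlt _ _ mp) (mlt _ _ mp').
  by apply/mnmP; apply: ord3P.
apply/mpolyP => m; rewrite mcoeff0.
have [mp|/memN_msupp_eq0 //] := boolP (m \in msupp p).
have := congr1 (fun q : {poly K} => q`_(e m)) r0.
rewrite coef0 coef_sum (bigD1_seq m) ?msupp_uniq //= coefZ coefXn eqxx mulr1.
rewrite big_seq_cond big1 ?addr0 // => m' /andP[mp' mm'].
by rewrite coefZ coefXn eq_sym (inj_in_eq einj) // (negPf mm') mulr0.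
Qed.

Lemma meval_homogZ p m x v :
  p \is m.-homog -> p.@[(x *: v) 0] = x ^+ m * p.@[v 0].
Proof.
move=> hp; rewrite !mevalE mulr_sumr big_seq [RHS]big_seq.
apply: eq_bigr => k kp; rewrite mulrCA; congr (_ * _).
have <- : mdeg k = m := dhomog_mf hp kp.
rewrite mdegE -prodrXr -big_split /=.
by apply: eq_bigr => j _; rewrite mxE exprMn.
Qed.

Lemma euler_homog p m : p \is m.-homog -> \sum_j 'X_j * p^`M(j) = p *+ m.
Proof.
move=> hp.
have e j : 'X_j * p^`M(j) = \sum_(k <- msupp p) (p@_k *: 'X_[k]) *+ k j.
  rewrite {1}[p]mpolyE raddf_sum mulr_sumr; apply: eq_bigr => k _ /=.
  rewrite mderivZ mderivX -!scalerAr -mpolyXD.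
  have [->|kj] := posnP (k j); first by rewrite mulr0n scale0r scaler0.
  rewrite addmC submK ?scaler_nat ?scalerMnr //.
  by apply/mnm_lepP => i; rewrite mnm1E; case: eqP => // <-.
under eq_bigr do rewrite e; rewrite exchange_big /=.
rewrite {3}[p]mpolyE -sumrMnl big_seq [RHS]big_seq; apply: eq_bigr => k kp.
have <- : mdeg k = m := dhomog_mf hp kp.
by rewrite sumrMnr -mdegE.
Qed.

(** Only the component of degree e - d of q contributes to the component of
    degree e of the product, which is the whole product. *)
Lemma dhomog_cancel p q d e :
  p != 0 -> p \is d.-homog -> p * q \is e.-homog -> q != 0 ->
  (d <= e)%N /\ q \is (e - d).-homog.
Proof.
move=> p0 hp hpq q0.
pose q' := \sum_(k < mmeasure mdeg q) if (d + k == e)%N then pihomog mdeg k q else 0.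
have qE : q = q'.
  apply: (mulfI p0); rewrite -(pihomog_dE hpq).
  rewrite {1}(pihomog_partitionE (leqnn (mmeasure mdeg q))) !mulr_sumr raddf_sum.
  apply: eq_bigr => k _ /=.
  have hk : p * pihomog mdeg k q \is (d + k).-homog.
    by apply: dhomogM => //; apply: pihomogP.
  case: eqP => [<-|/eqP ne]; first by rewrite pihomog_dE.
  by rewrite mulr0 (pihomog_ne0 ne).
have [de|ed] := leqP d e.
  split=> //; rewrite qE; apply: rpred_sum => k _.
  by case: eqP => [<-|_]; rewrite ?rpred0 // addKn pihomogP.
case/eqP: q0; rewrite qE /q' big1 // => k _.
by case: eqP => // de; move: ed; rewrite -de ltnNge leq_addr.
Qed.

Lemma comp_linear_homog (n n' : nat) (p : {mpoly K[n]}) (t : n.-tuple {mpoly K[n']}) m :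
  p \is m.-homog -> (forall j, tnth t j \is 1.-homog) -> p \mPo t \is m.-homog.
Proof.
move=> hp ht; rewrite comp_mpolyE big_seq; apply: rpred_sum => k kp.
have <- : mdeg k = m := dhomog_mf hp kp.
rewrite rpredZ // mdegE.
elim/big_ind2: _ => [|x d y e hx hy|j _]; [exact: dhomog1|exact: dhomogM|].
by have := dhomogMn (k j) (ht j); rewrite mul1n.
Qed.

(** When [dot a n = 1], this composes p with the projection along n onto the
    plane of normal a. It turns statements about that plane into identities
    between polynomials. *)
Definition cut a n p : {mpoly K[3]} :=
  p \mPo [tuple 'X_j - n 0 j *: linform a | j < 3].

Lemma meval_cut a n p v : (cut a n p).@[v 0] = p.@[(v - dot a v *: n) 0].
Proof.
rewrite /cut comp_mpoly_meval; apply: meval_eq => j.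
by rewrite tnth_mktuple mevalB mevalZ mevalXU meval_linform !mxE mulrC.
Qed.

Lemma cut_homog a n p m : p \is m.-homog -> cut a n p \is m.-homog.
Proof.
move=> hp; apply: comp_linear_homog => // j.
by rewrite tnth_mktuple rpredB ?rpredZ ?linform_homog // dhomogX /= mdeg1.
Qed.

Lemma cut_mod a n p : exists q, p - cut a n p = linform a * q.
Proof.
pose t := [tuple 'X_j - n 0 j *: linform a | j < 3].
have cl1 : exists q, 1 - (1 \mPo t) = linform a * q.
  by exists 0; rewrite comp_mpoly1 subrr mulr0.
have clM p1 p2 : (exists q, p1 - (p1 \mPo t) = linform a * q) ->
    (exists q, p2 - (p2 \mPo t) = linform a * q) ->
    exists q, p1 * p2 - ((p1 * p2) \mPo t) = linform a * q.
  move=> [q1 h1] [q2 h2]; exists (q1 * p2 + (p1 \mPo t) * q2).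
  rewrite rmorphM /= mulrDr mulrA -h1 mulrCA -h2; ring.
rewrite /cut -/t; elim/mpolyind: p => [|c k p _ _ [q hq]].
  by exists 0; rewrite comp_mpoly0 subrr mulr0.
have [q' hq'] : exists q, 'X_[k] - ('X_[k] \mPo t) = linform a * q.
  rewrite mpolyXE_id; elim/big_ind: _ => // j _.
  elim: (k j) => // i ih; rewrite exprS; apply: clM => //.
  exists (n 0 j)%:MP; rewrite comp_mpolyXU -tnth_nth tnth_mktuple opprB addrC subrK.
  by rewrite mulrC mul_mpolyC.
exists (c *: q' + q); rewrite comp_mpolyD comp_mpolyZ mulrDr -hq -scalerAr -hq'.
by rewrite scalerBr opprD addrACA.
Qed.

Lemma plane_proj a n v : dot a n = 1 -> dot a (v - dot a v *: n) = 0.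
Proof. by move=> an; rewrite dotDr dotNr dotZr an mulr1 subrr. Qed.

Lemma plane_proj_id a n v : dot a v = 0 -> v - dot a v *: n = v.
Proof. by move=> ->; rewrite scale0r subr0. Qed.

Definition vanishes_on a p := forall v, dot a v = 0 -> p.@[v 0] = 0.

Lemma vanishes_cut a n p : dot a n = 1 -> vanishes_on a p -> cut a n p = 0.
Proof.
move=> an h; apply: mpoly_vanish_eq0 => v; rewrite meval_cut.
by apply: h; apply: plane_proj.
Qed.

(** A polynomial is congruent, modulo the form a, to its composite with a
    projection onto the plane of a, which here is zero. *)
Lemma vanishes_divides a p :
  a != 0 -> vanishes_on a p -> exists q, p = linform a * q.
Proof.
move=> /exists_dot1[n an] h; have [q] := cut_mod a n p.
by rewrite (vanishes_cut an h) subr0 => ->; exists q.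
Qed.

Lemma vanishes_divides_homog a p m :
  a != 0 -> p \is m.-homog -> vanishes_on a p ->
  exists2 q, q \is m.-1.-homog & p = linform a * q.
Proof.
move=> a0 hp /(vanishes_divides a0)[q pq].
have [q0|q0] := eqVneq q 0.
  by exists 0; rewrite ?rpred0 // pq q0.
exists q => //; rewrite -subn1; rewrite pq in hp.
by have [] := dhomog_cancel _ (linform_homog a) hp q0; rewrite ?linform_eq0.
Qed.

(** The plane is irreducible: composition with the projection embeds the
    functions on it in the integral domain of polynomials. *)
Lemma vanishes_onM a p q :
  a != 0 -> vanishes_on a (p * q) -> vanishes_on a p \/ vanishes_on a q.
Proof.
move=> /exists_dot1[n an] h.
have /eqP := vanishes_cut an h; rewrite /cut rmorphM mulf_eq0 /=.
have back r : cut a n r == 0 -> vanishes_on a r.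
  move=> /eqP r0 v av.
  by rewrite -[v](plane_proj_id n av) -meval_cut r0 meval0.
by case/orP => /back; [left|right].
Qed.

Lemma vanishes_linform a b : vanishes_on a (linform b) -> cross a b = 0.
Proof.
move=> h; apply: dot_eq0 => v; rewrite -[LHS]/(det3 a b v) det3_cycle -det3_dot.
by rewrite -meval_linform; apply: h; apply: dot_crossr.
Qed.

End Polynomials.

Section Forms.

Variable K : fieldType.
Hypothesis charK : [pchar K] =i pred0.
Implicit Types (p q : {mpoly K[3]}) (a b f g n u v : 'rV[K]_3).
Implicit Types (w : 'rV[{mpoly K[3]}]_3).

(** A vector space over an infinite field is not a finite union of hyperplanes:
    the product of their equations is a nonzero polynomial. *)
Lemma generic_vector (s : seq 'rV[K]_3) :
  {in s, forall u, u != 0} -> exists v, {in s, forall u, dot u v != 0}.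
Proof.
move=> s0; pose p := \prod_(u <- s) linform u.
have p0 : p != 0.
  by rewrite prodf_seq_neq0; apply/allP => u /s0; rewrite linform_eq0.
have [[v pv]|no] := pselect (exists v : 'rV[K]_3, p.@[v 0] != 0).
  exists v; move: pv; rewrite /p rmorph_prod /= prodf_seq_neq0 => /allP pv u us.
  by have := pv u us; rewrite meval_linform.
case/eqP: p0; apply: (mpoly_vanish_eq0 charK) => v; apply/eqP.
by apply: contra_notT no => pv; exists v.
Qed.

(** On the plane of a, which is a projective line, each zero of a homogeneous
    polynomial splits off a linear factor. The zeros are presented as
    intersections with the planes of s; distinct ones correspond to nonzero
    determinants. *)
Lemma plane_factor a (s : seq 'rV[K]_3) m p :
  {in s, forall f, cross a f != 0} ->
  pairwise (fun f g => det3 a f g != 0) s ->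
  p \is m.-homog ->
  {in s, forall f, p.@[(cross a f) 0] = 0} ->
  exists q, [/\ q \is (m - size s).-homog, (m < size s)%N -> q = 0 &
    forall v, dot a v = 0 -> p.@[v 0] = q.@[v 0] * \prod_(f <- s) dot f v].
Proof.
elim: s m p => [|f s ih] m p /= sa sp hp sv.
  exists p; split=> // [|v _]; first by rewrite subn0.
  by rewrite big_nil mulr1.
have af : cross a f != 0 by apply: sa; rewrite inE eqxx.
have [n an] := exists_dot1 (cross_neq0_neq0 af).1.
pose f' := f - dot f n *: a.
(* [f'] is the form f composed with the projection onto the plane of a. *)
have f'0 : f' != 0.
  apply: contraNneq af => /eqP; rewrite subr_eq0 => /eqP ->.
  by rewrite crossZr cross_self scaler0.
have cv : vanishes_on f' (cut a n p).
  move=> v f'v; rewrite meval_cut; set u := v - _.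
  have au : dot a u = 0 by apply: plane_proj.
  have fu : dot f u = 0.
    by rewrite -f'v /u /f' dotDr dotNr dotZr -scaleNr dotDl dotZl; ring.
  have [x ->] := dot2_eq0P af au fu.
  by rewrite (meval_homogZ _ _ hp) sv ?inE ?eqxx // mulr0.
have [q hq pq] := vanishes_divides_homog charK f'0 (cut_homog _ _ hp) cv.
have pE v : dot a v = 0 -> p.@[v 0] = dot f v * q.@[v 0].
  move=> av; rewrite -{1}[v](plane_proj_id n av) -meval_cut pq mevalM.
  by rewrite meval_linform /f' -scaleNr dotDl dotZl av mulr0 addr0.
case: m => [|m] in hp hq *.
  have q0 : q = 0.
    apply/eqP; apply: contraT => q0; have := cut_homog a n hp; rewrite pq => h.
    by have [] := dhomog_cancel _ (linform_homog f') h q0; rewrite ?linform_eq0.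
  exists 0; split=> // [|v av]; first exact: rpred0.
  by rewrite pE // q0 meval0 mulr0 mul0r.
have sq : {in s, forall g, q.@[(cross a g) 0] = 0}.
  move=> g gs; have := sv g; rewrite inE gs orbT pE ?dot_crossl // => /(_ isT).
  move=> /eqP; rewrite mulf_eq0 det3_dot det3C oppr_eq0 => /orP[|/eqP//].
  by move: sp => /andP[/allP/(_ g gs)/negPf -> _].
have sa' : {in s, forall g, cross a g != 0}.
  by move=> g gs; apply: sa; rewrite inE gs orbT.
have [r [hr r0 rE]] := ih m q sa' (andP sp).2 hq sq.
exists r; split=> // v av.
by rewrite pE // rE // big_cons mulrCA.
Qed.

Lemma plane_vanish a (s : seq 'rV[K]_3) m p :
  {in s, forall f, cross a f != 0} ->
  pairwise (fun f g => det3 a f g != 0) s ->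
  p \is m.-homog -> {in s, forall f, p.@[(cross a f) 0] = 0} ->
  (m < size s)%N -> vanishes_on a p.
Proof.
move=> sa sp hp sv ms; have [q [_ /(_ ms) -> h]] := plane_factor sa sp hp sv.
by move=> v /h ->; rewrite meval0 mul0r.
Qed.

(** * Logarithmic forms along a family of planes *)

(** The position vector, which is also the radial vector field. *)
Definition varvec : 'rV[{mpoly K[3]}]_3 := \row_j 'X_j.
Definition cstvec u : 'rV[{mpoly K[3]}]_3 := map_mx (@mpolyC 3 K) u.
Definition gradvec p : 'rV[{mpoly K[3]}]_3 := \row_j p^`M(j).
Definition evalvec w v : 'rV[K]_3 := map_mx (meval (v 0)) w.

(** For w = X x theta this is tangency of theta to the plane: at a point v of it,
    both v and theta (v) lie in the plane, so that their product is normal. *)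
Definition normal_along a w := forall v, dot a v = 0 -> cross (evalvec w v) a = 0.

(** The condition [dot varvec w = 0] characterizes the cross products X x theta,
    among which w stands for the field theta modulo multiples of X. *)
Definition log_form (T : finType) (a : T -> 'rV[K]_3) (B : {set T}) m w :=
  [/\ forall j, w 0 j \is m.-homog, dot varvec w = 0 &
      forall i, i \in B -> normal_along (a i) w].

Definition has_log_form (T : finType) (a : T -> 'rV[K]_3) (B : {set T}) m :=
  exists2 w, log_form a B m w & w != 0.

Lemma polyvecZ_eq0 p w : (p *: w == 0) = (p == 0) || (w == 0).
Proof.
apply/eqP/orP => [pw|[/eqP p0|/eqP w0]]; last 2 first.
- by rewrite p0 scale0r.
- by rewrite w0 scaler0.
have [_|p0] := eqVneq p 0; [by left|right].
by apply/eqP/rowP => j; apply: (mulfI p0); have /rowP/(_ j) := pw; rewrite !mxE mulr0.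
Qed.

Lemma meval_dot w w' v : (dot w w').@[v 0] = dot (evalvec w v) (evalvec w' v).
Proof. by rewrite !dotE !mevalD !mevalM !mxE. Qed.

Lemma evalvec_cross w w' v :
  evalvec (cross w w') v = cross (evalvec w v) (evalvec w' v).
Proof. by apply: row3P; rewrite mxE !crossE mevalB !mevalM !mxE. Qed.

Lemma evalvec_cst u v : evalvec (cstvec u) v = u.
Proof. by apply/rowP => j; rewrite !mxE mevalC. Qed.

Lemma evalvec_var v : evalvec varvec v = v.
Proof. by apply/rowP => j; rewrite !mxE mevalXU. Qed.

Lemma evalvecZ p w v : evalvec (p *: w) v = p.@[v 0] *: evalvec w v.
Proof. by apply/rowP => j; rewrite !mxE mevalM. Qed.

Lemma normal_alongP a w :
  normal_along a w <-> forall j, vanishes_on a (cross w (cstvec a) 0 j).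
Proof.
split=> h => [j v av|v av].
  have /rowP/(_ j) := h v av.
  by rewrite -{1}(evalvec_cst a v) -evalvec_cross !mxE.
apply/rowP => j; have := h j v av.
by rewrite -{2}(evalvec_cst a v) -evalvec_cross !mxE.
Qed.

(** On the plane i the product vanishes; on the others it is a multiple of w. *)
Lemma log_formZ (T : finType) (a : T -> 'rV[K]_3) (B : {set T}) m w i :
  log_form a (B :\ i) m w -> log_form a B m.+1 (linform (a i) *: w).
Proof.
move=> [hw xw lw]; split=> [j||k kB v kv].
- by rewrite mxE -(add1n m); apply: dhomogM => //; apply: linform_homog.
- by rewrite dotZr xw mulr0.
rewrite evalvecZ meval_linform crossZl.
have [ki|ki] := eqVneq k i; first by rewrite -ki kv scale0r.
by rewrite lw ?scaler0 // !inE ki.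
Qed.


Lemma has_log_formS (T : finType) (a : T -> 'rV[K]_3) (B : {set T}) m i :
  a i != 0 -> has_log_form a (B :\ i) m -> has_log_form a B m.+1.
Proof.
move=> ai [w hw w0]; exists (linform (a i) *: w); first exact: log_formZ.
by rewrite polyvecZ_eq0 linform_eq0 negb_or ai.
Qed.

Lemma has_log_form_le (T : finType) (a : T -> 'rV[K]_3) (B : {set T}) m m' :
  (m <= m')%N -> has_log_form a B m -> has_log_form a B m'.
Proof.
move=> /subnK <-; elim: (m' - m)%N => // k ih /ih [w [hw xw lw] w0].
exists ('X_0 *: w).
  split=> [j||i iB v iv].
  - by rewrite mxE addSn -(add1n (k + m)); apply: dhomogM; rewrite // dhomogX /= mdeg1.
  - by rewrite dotZr xw mulr0.
  - by rewrite evalvecZ crossZl lw ?scaler0.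
by rewrite polyvecZ_eq0 negb_or w0 andbT -msize_poly_eq0 msizeX.
Qed.

(** Multiply by the equations of the planes of B outside of C. *)
Lemma has_log_form_add (T : finType) (a : T -> 'rV[K]_3) (B C : {set T}) m :
  (forall i, a i != 0) -> C \subset B ->
  has_log_form a C m -> has_log_form a B (m + (#|B| - #|C|)).
Proof.
move=> a0; move: {2}(#|B| - #|C|)%N (leqnn (#|B| - #|C|)) => k.
elim: k B => [|k ih] B Bk CB hC.
  have -> : B = C.
    by apply/eqP; rewrite eq_sym eqEcard CB -subn_eq0 -leqn0.
  by rewrite subnn addn0.
have [/eqP BC|] := boolP (B == C); first by rewrite BC subnn addn0.
rewrite eqEsubset CB andbT => /subsetPn[i iB iC].
have CBi : C \subset B :\ i by rewrite subsetD1 CB.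
have cB := cardsD1 i B; rewrite iB add1n in cB.
have le := subset_leq_card CBi.
rewrite cB subSn // addnS; apply: (has_log_formS (a0 i)); apply: ih => //.
by move: Bk; rewrite cB subSn.
Qed.

(** * Syzygies and logarithmic forms *)

Definition plane_product (T : finType) (a : T -> 'rV[K]_3) := \prod_i linform (a i).

Definition pairwise_indep (T : finType) (a : T -> 'rV[K]_3) :=
  (forall i, a i != 0) /\ (forall i j, i != j -> cross (a i) (a j) != 0).

Section Conversion.

Variables (T : finType) (a : T -> 'rV[K]_3).
Hypothesis ha : pairwise_indep a.

Let F := plane_product a.

Lemma plane_product_neq0 : F != 0.
Proof. by apply/prodf_neq0 => i _; rewrite linform_eq0 ha.1. Qed.

Lemma plane_product_homog : F \is #|T|.-homog.
Proof.
rewrite /F /plane_product -sum1_card.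
elim/big_ind2: _ => [|p d q e hp hq|i _]; [exact: dhomog1|exact: dhomogM|].
exact: linform_homog.
Qed.

Lemma cofactor_not_vanish i (r : seq T) :
  i \notin r -> ~ vanishes_on (a i) (\prod_(j <- r) linform (a j)).
Proof.
elim: r => [_ /(_ 0)|j r ih].
  by rewrite big_nil dot0r meval1 => /(_ erefl) /eqP; rewrite oner_eq0.
rewrite inE negb_or big_cons => /andP[ij ir] /(vanishes_onM charK (ha.1 i))[|].
  by move=> /vanishes_linform /eqP; rewrite (negPf (ha.2 _ _ ij)).
exact: ih.
Qed.

Lemma planes_divide (r : seq T) p :
  uniq r -> {in r, forall i, vanishes_on (a i) p} ->
  exists q, p = (\prod_(i <- r) linform (a i)) * q.
Proof.
elim: r p => [|i r ih] p /=; first by exists p; rewrite big_nil mul1r.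
move=> /andP[ir ur] hp.
have [q pq] := vanishes_divides charK (ha.1 i) (hp i (mem_head _ _)).
have hq : {in r, forall j, vanishes_on (a j) q}.
  move=> j jr; have := hp j; rewrite inE jr orbT pq => /(_ isT).
  move=> /(vanishes_onM charK (ha.1 j))[|//] /vanishes_linform /eqP.
  rewrite (negPf (ha.2 _ _ _)) //; by apply: contraNneq ir => <-.
have [q' qE] := ih q ur hq.
by exists q'; rewrite pq big_cons {1}qE mulrA.
Qed.

Lemma gradvecM p q : gradvec (p * q) = p *: gradvec q + q *: gradvec p.
Proof. by apply/rowP => j; rewrite !mxE mderivM addrC [q * _]mulrC. Qed.

Lemma gradvec_linform b : gradvec (linform b) = cstvec b.
Proof. by apply/rowP => j; rewrite !mxE mderiv_linform. Qed.

(** If F = l g with l the equation of the plane i, then grad F is g grad l on it. *)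
Lemma grad_plane_product i : exists2 g, ~ vanishes_on (a i) g &
  forall v, dot (a i) v = 0 -> evalvec (gradvec F) v = g.@[v 0] *: a i.
Proof.
exists (\prod_(j <- rem i (index_enum T)) linform (a j)).
  by apply: cofactor_not_vanish; rewrite mem_rem_uniq ?index_enum_uniq ?inE ?eqxx.
move=> v av; rewrite /F /plane_product (perm_big _ (perm_to_rem (mem_index_enum i))).
rewrite big_cons gradvecM gradvec_linform; apply/rowP => j.
by rewrite !mxE mevalD !mevalM meval_linform av mul0r add0r mevalC.
Qed.

Lemma euler_plane_product : dot varvec (gradvec F) = F *+ #|T|.
Proof.
rewrite -(euler_homog plane_product_homog); apply: eq_bigr => j _.
by rewrite !mxE.
Qed.

Lemma mulrn_neq0 p k : p != 0 -> p *+ k.+1 != 0.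
Proof.
move=> p0; rewrite -scaler_nat scaler_eq0 negb_or p0 andbT.
exact: natr_neq0.
Qed.

Hypothesis T_gt0 : (0 < #|T|)%N.

(** A field s with s . grad F = 0 is tangent to the planes, because grad F is a
    generically nonzero multiple of the normal there. It is not radial, since
    X . grad F is a nonzero multiple of F. *)
Lemma log_form_of_syzygy k :
  jacobian_syzygy F k -> has_log_form a setT k.+1.
Proof.
move=> [s' [hs [j0 sj0] sF]]; pose s : 'rV_3 := \row_j s' j.
have s0 : s != 0 by apply: contraNneq sj0 => /rowP/(_ j0); rewrite !mxE => ->.
have sG : dot s (gradvec F) = 0.
  by rewrite -sF; apply: eq_bigr => j _; rewrite !mxE.
exists (cross varvec s); last first.
  apply/eqP => xs; have := double_cross varvec s (gradvec F).
  rewrite xs cross0l euler_plane_product sG scale0r subr0 => /esym/eqP.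
  rewrite polyvecZ_eq0 (negPf s0) orbF -(prednK T_gt0).
  by rewrite (negPf (mulrn_neq0 _ plane_product_neq0)).
split=> [j||i _ v av]; last 1 first.
- rewrite evalvec_cross evalvec_var double_cross [dot v _]dotC av scale0r sub0r.
  have [g g0 gE] := grad_plane_product i.
  have /(vanishes_onM charK (ha.1 i))[//|] :
      vanishes_on (a i) (g * dot s (cstvec (a i))).
    move=> u au; rewrite mevalM meval_dot evalvec_cst -dotZr -gE //.
    by rewrite -meval_dot sG meval0.
  by move=> /(_ v av); rewrite meval_dot evalvec_cst => ->; rewrite scale0r oppr0.
- by rewrite !mxE -(add1n k) rpredB //; apply: dhomogM; rewrite // dhomogX /= mdeg1.
- exact: dot_crossl.
Qed.

(** On each plane both w and grad F are normal to it, so their cross product is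
    divisible by F. The quotient is orthogonal to grad F; it is nonzero because
    (w x grad F) x X is a nonzero multiple of F w. *)
Lemma syzygy_of_log_form k :
  has_log_form a setT k.+1 -> jacobian_syzygy F k.
Proof.
move=> [w [hw xw lw] w0]; pose W := cross w (gradvec F).
have Wv j : exists h, W 0 j = F * h.
  apply: planes_divide => [|i _ v av]; first exact: index_enum_uniq.
  have [g _ gE] := grad_plane_product i.
  have /rowP/(_ j) : evalvec W v = 0.
    by rewrite evalvec_cross gE // crossZr lw ?scaler0 ?inE.
  by rewrite !mxE.
have [h hE] := choice Wv.
have WE : W = F *: (\row_j h j) by apply/rowP => j; rewrite hE !mxE.
exists h; split.
- move=> j; have [->|hj] := eqVneq (h j) 0; first exact: rpred0.
  have hW : W 0 j \is (k.+1 + #|T|.-1).-homog.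
    rewrite mxE rpredB //; apply: dhomogM => //; rewrite mxE.
      exact/mderiv_homog/plane_product_homog.
    exact/mderiv_homog/plane_product_homog.
  rewrite hE in hW.
  have [_] := dhomog_cancel plane_product_neq0 plane_product_homog hW hj.
  by rewrite -(prednK T_gt0) /= addSnnS addnK.
- apply/existsP; apply: contraT; rewrite negb_exists => /forallP h0.
  have W0 : W = 0 by apply/rowP => j; rewrite hE (eqP (negbNE (h0 j))) mulr0 mxE.
  have := double_cross w (gradvec F) varvec; rewrite -/W W0 cross0l.
  rewrite [dot w _]dotC xw scale0r sub0r dotC euler_plane_product => /esym/eqP.
  rewrite oppr_eq0 polyvecZ_eq0 (negPf w0) orbF -(prednK T_gt0).
  by rewrite (negPf (mulrn_neq0 _ plane_product_neq0)).
have := dot_crossr w (gradvec F); rewrite -/W WE dotZr dotC => /eqP.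
rewrite mulf_eq0 (negPf plane_product_neq0) => /eqP hG.
by apply: etrans hG; apply: eq_bigr => j _; rewrite !mxE.
Qed.

End Conversion.

End Forms.

(** * Concurrent triples *)

Section Triples.

Variables (T : finType) (c : T -> T -> T -> bool).
Implicit Types (B C X : {set T}).

Definition triples B : {set {set T}} :=
  [set X : {set T} | [&& X \subset B, #|X| == 3%N &
    [forall i in X, [forall j in X, [forall k in X, c i j k]]]]].

Definition triples_through B i := [set X in triples B | i \in X].

Lemma mem_through B i X :
  (X \in triples_through B i) = (X \in triples B) && (i \in X).
Proof. by rewrite inE. Qed.

Definition valency B i := #|triples_through B i|.

Lemma triplesS B C : B \subset C -> triples B \subset triples C.
Proof.
move=> BC; apply/subsetP => X; rewrite !inE => /and3P[XB -> ->].
by rewrite (subset_trans XB BC).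
Qed.

Lemma valencyS B C i : B \subset C -> (valency B i <= valency C i)%N.
Proof.
move=> BC; apply/subset_leq_card/subsetP => X; rewrite inE => /andP[XB iX].
by rewrite inE iX andbT (subsetP (triplesS BC)).
Qed.

Lemma card_triplesD1 B i :
  #|triples B| = (#|triples (B :\ i)| + valency B i)%N.
Proof.
rewrite -(cardsID [set X : {set T} | i \in X] (triples B)) addnC.
congr (_ + _)%N; apply: eq_card => X; rewrite !inE // subsetD1.
by case: (i \in X); rewrite ?andbT ?andbF.
Qed.

Lemma sum_valency B : (\sum_(i in B) valency B i = 3 * #|triples B|)%N.
Proof.
rewrite -sum1_card big_distrr /=.
transitivity (\sum_(i in B) \sum_(X in triples B | i \in X) 1)%N.
  apply: eq_bigr => i _; rewrite sum1_card; apply: eq_card => X.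
  by rewrite [LHS]inE.
rewrite (exchange_big_dep (mem (triples B))) /=; last by move=> i X _ /andP[].
apply: eq_bigr => X XB; move: (XB); rewrite inE => /and3P[/subsetP sX /eqP cX _].
transitivity #|X|; last by rewrite muln1.
rewrite -[RHS]sum1_card; apply: eq_bigl => i.
have [/sX ->|_] := boolP (i \in X); rewrite ?andbF // andbT.
by move: XB; rewrite inE.
Qed.

(** A core cannot be reduced by the removal of members lying in at most one
    triple. *)
Definition is_core B := (B != set0) && [forall i in B, 1 < valency B i]%N.

(** With at most five triples, the minimal degree of a logarithmic form for two or
    more planes turns out to be #|B| - 1 - defect B. *)
Definition defect B : nat :=
  if triples B == set0 then 0%N
  else if [exists C : {set T}, (C \subset B) && is_core C] then 2%N else 1%N.

Lemma defectS B C : B \subset C -> (defect B <= defect C)%N.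
Proof.
move=> BC; rewrite /defect; have [//|B0] := eqVneq (triples B) set0.
have -> : (triples C == set0) = false.
  apply/negbTE; apply: contraNneq B0 => C0.
  by rewrite -subset0 -C0 triplesS.
case: existsP => [[D /andP[DB cD]]|_]; last by case: ifP.
by case: existsP => // -[]; exists D; rewrite cD (subset_trans DB BC).
Qed.

(** This holds when at most three planes share a line: two of them then
    determine the third. *)
Definition linear_triples := forall X Y i j,
  X \in triples setT -> Y \in triples setT -> i != j ->
  i \in X -> j \in X -> i \in Y -> j \in Y -> X = Y.

Hypothesis lin : linear_triples.

(** The triples through i have pairwise disjoint sets of two other members. *)
Lemma valency_lt B i : i \in B -> (2 * valency B i < #|B|)%N.
Proof.
move=> iB; rewrite (cardsD1 i B) iB add1n ltnS.
have toT X : X \in triples B -> X \in triples setT.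
  exact: (subsetP (triplesS (subsetT B))).
have -> : (2 * valency B i
    = \sum_(j in B :\ i) \sum_(X in triples_through B i | j \in X) 1)%N.
  rewrite (exchange_big_dep (mem (triples_through B i))) /=; last first.
    by move=> j X _ /andP[].
  rewrite mulnC /valency -sum1_card big_distrl /=; apply: eq_bigr => X Xi.
  have /andP[XB iX] : (X \in triples B) && (i \in X) by rewrite -mem_through.
  move: XB; rewrite inE => /and3P[/subsetP sX /eqP cX _].
  have -> : (1 * 2 = #|X :\ i|)%N by move: cX; rewrite (cardsD1 i X) iX; lia.
  rewrite -[LHS]sum1_card; apply: eq_bigl => j; rewrite !in_setD1.
  have [/sX ->|_] := boolP (j \in X); rewrite ?andbF // !andbT.
  by move: Xi; rewrite mem_through; case: (j != i) => // ->.
rewrite -sum1_card; apply: leq_sum => j; rewrite !inE => /andP[ji _].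
rewrite sum1_card; apply/card_le1_eqP => X Y /andP[+ jX] /andP[+ jY].
rewrite !mem_through => /andP[XB iX] /andP[YB iY].
by apply: (@lin Y X i j) => //; rewrite ?toT // eq_sym.
Qed.

(** With all valencies at least 3, the family would have at least seven
    members, but at most as many as there are triples. *)
Lemma exists_small_valency B :
  (#|triples B| <= 5)%N -> B != set0 -> exists2 i, i \in B & (valency B i <= 2)%N.
Proof.
move=> n5 /set0Pn[i0 i0B].
have [/exists_inP[i iB h]|] := boolP [exists i in B, (valency B i <= 2)%N].
  by exists i.
rewrite negb_exists_in => /forall_inP h.
have h3 i : i \in B -> (2 < valency B i)%N by move=> /h; rewrite -ltnNge.
have lB : (#|B| * 3 <= \sum_(i in B) valency B i)%N.
  by rewrite -sum_nat_const; apply: leq_sum => i /h3.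
have := valency_lt i0B; have := h3 _ i0B; move: lB; rewrite sum_valency.
lia.
Qed.

Lemma exists_valency_le_defect B :
  (#|triples B| <= 5)%N -> B != set0 ->
  exists2 i, i \in B & (valency B i <= defect B)%N.
Proof.
move=> n5 B0; rewrite /defect; have [tB|_] := eqVneq (triples B) set0.
  have /set0Pn[i iB] := B0; exists i => //.
  rewrite leqn0 cards_eq0; apply/eqP/setP => X.
  by rewrite /triples_through tB !inE.
case: existsP => [_|no]; first exact: exists_small_valency.
have [/exists_inP[i iB h]|] := boolP [exists i in B, (valency B i <= 1)%N].
  by exists i.
rewrite negb_exists_in => /forall_inP h; case: no; exists B.
rewrite subxx /is_core B0; apply/forall_inP => i /h; by rewrite -ltnNge.
Qed.

(** Double counting, with at most five triples in all, makes a core have almost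
    as many triples as members. *)
Lemma core_card C :
  (#|triples C| <= 5)%N -> is_core C -> (5 <= #|C|)%N /\ (#|C| <= #|triples C| + 2)%N.
Proof.
move=> n5 /andP[/set0Pn[i iC] /forall_inP h].
have lC : (#|C| * 2 <= \sum_(i in C) valency C i)%N.
  by rewrite -sum_nat_const; apply: leq_sum => j /h.
have := valency_lt iC; have := h _ iC; move: lC; rewrite sum_valency.
lia.
Qed.

End Triples.

(** An arbitrary choice, made once for all, of a second member of a triple. *)
Definition other_member (T : finType) (i : T) (X : {set T}) : T :=
  odflt i [pick j in X :\ i].

Lemma other_memberP (T : finType) (i : T) (X : {set T}) :
  (1 < #|X|)%N -> other_member i X \in X :\ i.
Proof.
move=> X1; rewrite /other_member; case: pickP => //= X0.
have := cardsD1 i X; rewrite (_ : X :\ i = set0) ?cards0; last first.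
  by apply/setP => j; have := X0 j; rewrite !inE.
by case: (i \in X); lia.
Qed.

(** * Removing a plane *)

Section Deletion.

Variable K : fieldType.
Hypothesis charK : [pchar K] =i pred0.
Variables (T : finType) (a : T -> 'rV[K]_3).
Hypothesis ha : pairwise_indep a.
Implicit Types (B X : {set T}) (f g : 'rV[K]_3) (w : 'rV[{mpoly K[3]}]_3).

Definition concurrent i j k := det3 (a i) (a j) (a k) == 0.

Lemma concurrentC i j k : concurrent i j k = concurrent j i k.
Proof. by rewrite /concurrent det3C oppr_eq0. Qed.

Lemma concurrent_cycle i j k : concurrent i j k = concurrent j k i.
Proof. by rewrite /concurrent det3_cycle. Qed.

Lemma concurrent_self i j : concurrent i i j.
Proof. by rewrite /concurrent det3uu. Qed.

Lemma set3_triple B i j k :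
  i \in B -> j \in B -> k \in B -> i != j -> i != k -> j != k ->
  concurrent i j k -> [set i; j; k] \in triples concurrent B.
Proof.
move=> iB jB kB ij ik jk cijk; rewrite inE; apply/and3P; split.
- by rewrite !subUset !sub1set iB jB kB.
- by rewrite setUC cardsU1 cards2 !inE !(eq_sym k) (negPf ik) (negPf jk) ij.
have s1 x y : concurrent x y x by rewrite 2!concurrent_cycle concurrent_self.
have s2 x y : concurrent x y y by rewrite concurrent_cycle concurrent_self.
have c1 := cijk; have c2 := cijk; rewrite concurrent_cycle in c2.
have c3 := c2; rewrite concurrent_cycle in c3.
have c4 := cijk; rewrite concurrentC in c4.
have c5 := c4; rewrite concurrent_cycle in c5.
have c6 := c5; rewrite concurrent_cycle in c6.
apply/forall_inP => x xX; apply/forall_inP => y yX; apply/forall_inP => z zX.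
move: xX yX zX; rewrite !inE -!orbA.
by do 3![case/or3P => /eqP ->]; rewrite ?concurrent_self ?s1 ?s2.
Qed.

Lemma tripleP B X : X \in triples concurrent B ->
  forall i, i \in X -> exists j k,
  [/\ X = [set i; j; k], [/\ i \in B, j \in B & k \in B],
      [/\ i != j, i != k & j != k] & concurrent i j k].
Proof.
rewrite inE => /and3P[/subsetP sX cX /forall_inP cc] i iX.
have : #|X :\ i| == 2%N by move: cX; rewrite (cardsD1 i X) iX.
move=> /cards2P[j [k [jk Xi]]].
have [jX kX] : (j \in X :\ i) /\ (k \in X :\ i) by rewrite Xi !inE !eqxx orbT.
move: jX kX; rewrite !inE => /andP[ji jX] /andP[ki kX].
exists j, k; split.
- by rewrite -[X](setD1K iX) Xi setUA.
- by split; apply: sX.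
- by split; rewrite // eq_sym.
- by have /forall_inP/(_ j jX)/forall_inP/(_ k kX) := cc i iX.
Qed.

(** At the intersection of two of its planes, a logarithmic form is normal to
    both, hence zero. *)
Lemma normal_two_planes f g v w :
  cross f g != 0 -> dot f v = 0 -> dot g v = 0 ->
  normal_along f w -> normal_along g w -> evalvec w v = 0.
Proof.
move=> fg fv gv hf hg; have := hf _ fv; have := hg _ gv.
set u := evalvec w _ => ug uf; apply/eqP; apply: contraT => u0.
have [x fE] := cross_eq0P u0 uf; have [y gE] := cross_eq0P u0 ug.
by case/eqP: fg; rewrite fE gE crossZl crossZr cross_self !scaler0.
Qed.

(** The form vanishes on the intersections of the plane i with the other members
    of B; these are #|B| - 1 lines, less one for each triple through i. If the
    degree is smaller than their number, the form vanishes on the plane i and is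
    divisible by its equation. *)
Lemma log_form_delete B m i :
  i \in B -> ((m + valency concurrent B i).+1 < #|B|)%N ->
  has_log_form a B m -> (0 < m)%N /\ has_log_form a (B :\ i) m.-1.
Proof.
move=> iB small [w [hw xw lw] w0].
(* One member is dropped from each triple, so that those of J meet the plane i
   in distinct lines. *)
pose R := [set other_member i X | X in triples_through concurrent B i].
pose J := (B :\ i) :\: R.
have cJ : (m < #|J|)%N.
  have cR : (#|R| <= valency concurrent B i)%N by apply: leq_imset_card.
  have := cardsID R (B :\ i); have := cardsD1 i B; rewrite iB add1n.
  have := subset_leq_card (subsetIr (B :\ i) R).
  by move: small cR; rewrite -/J; lia.
have Jdet : {in J &, forall j k, j != k -> ~~ concurrent i j k}.
  move=> j k; rewrite !inE => /and3P[jR ji jB] /and3P[kR ki kB] jk.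
  apply/negP => cijk; have ij : i != j by rewrite eq_sym.
  have ik : i != k by rewrite eq_sym.
  have XB := set3_triple iB jB kB ij ik jk cijk; set X := [set i; j; k] in XB.
  have XR : other_member i X \in R by rewrite imset_f // inE XB !inE eqxx.
  have : other_member i X \in X :\ i.
    by apply: other_memberP; move: XB; rewrite inE => /and3P[_ /eqP -> _].
  rewrite !inE => /andP[/negPf ->] /= /orP[]/eqP e; move: XR; rewrite e.
    by rewrite (negPf jR).
  by rewrite (negPf kR).
pose s := [seq a j | j <- enum J].
have van l : vanishes_on (a i) (w 0 l).
  apply: (@plane_vanish _ charK _ s m) => //.
  - move=> _ /mapP[j + ->]; rewrite mem_enum !inE => /and3P[_ ji _].
    by apply: ha.2; rewrite eq_sym.
  - rewrite pairwise_map; have := enum_uniq (mem J); rewrite uniq_pairwise.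
    apply: (@sub_in_pairwise _ (mem J)); last by apply/allP => j; rewrite mem_enum.
    by move=> j k jJ kJ; apply: Jdet.
  - move=> _ /mapP[j + ->]; rewrite mem_enum !inE => /and3P[_ ji jB].
    have /rowP/(_ l) := normal_two_planes (ha.2 i j (contra_neq esym ji))
      (dot_crossl _ _) (dot_crossr _ _) (lw i iB) (lw j jB).
    by rewrite !mxE.
  - by rewrite size_map -cardE.
have qE l : exists q, q \is m.-1.-homog /\ w 0 l = linform (a i) * q.
  by have [q hq wq] := vanishes_divides_homog charK (ha.1 i) (hw l) (van l); exists q.
have [q {}qE] := choice qE.
have wE : w = linform (a i) *: \row_l q l by apply/rowP => l; rewrite !mxE (qE l).2.
have q0 : (\row_l q l) != 0.
  by apply: contraNneq w0 => q0; rewrite wE q0 scaler0.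
split.
  rewrite lt0n; apply: contraNneq q0 => m0; apply/eqP/rowP => l; rewrite !mxE.
  apply/eqP; apply: contraT => ql; have := hw l; rewrite m0 (qE l).2 => h.
  by have [] := dhomog_cancel _ (linform_homog (a i)) h ql; rewrite ?linform_eq0 ?ha.1.
exists (\row_l q l) => //; split.
- by move=> l; rewrite mxE (qE l).1.
- move: xw; rewrite wE dotZr => /eqP; rewrite mulf_eq0 linform_eq0 (negPf (ha.1 i)).
  by move/eqP.
move=> j; rewrite !inE => /andP[ji jB]; apply/normal_alongP => l.
have /normal_alongP/(_ l) := lw j jB; rewrite wE crossZl mxE.
move=> /(vanishes_onM charK (ha.1 j))[|//] /vanishes_linform /eqP.
by rewrite (negPf (ha.2 _ _ ji)).
Qed.

(** Some plane has valency at most the defect. Either the degree is already as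
    large as claimed, or that plane can be removed and the degree lowered by one. *)
Theorem log_form_degree_ge B m :
  linear_triples concurrent -> (#|triples concurrent B| <= 5)%N ->
  has_log_form a B m -> (#|B| <= (m + defect concurrent B).+1)%N.
Proof.
move=> lin; move: {2}#|B| (leqnn #|B|) => n.
elim: n B m => [|n ih] B m Bn n5 hm.
  by apply: (leq_trans Bn).
have [->|B0] := eqVneq B set0; first by rewrite cards0.
have [i iB vi] := exists_valency_le_defect lin n5 B0.
have [le|gt] := leqP #|B| (m + valency concurrent B i).+1.
  by apply: (leq_trans le); rewrite ltnS leq_add2l.
have [m0 hm'] := log_form_delete iB gt hm.
have sB := subsetDl B [set i].
have cB := cardsD1 i B; rewrite iB in cB.
have n5' := leq_trans (subset_leq_card (triplesS concurrent sB)) n5.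
have := ih _ _ _ n5' hm'; have := defectS concurrent sB.
have := Bn; lia.
Qed.

End Deletion.

(** * Low degree forms from a dimension count *)

Section DimensionCount.

Variable K : fieldType.
Hypothesis charK : [pchar K] =i pred0.
Implicit Types (f g u v : 'rV[K]_3).

Lemma exists_cross_neq0 u : u != 0 -> exists v, cross u v != 0.
Proof.
move=> u0; have [//|no] := pselect (exists v, cross u v != 0).
have {}no v : cross u v = 0.
  by apply/eqP; apply: contra_notT no => h; exists v.
case/eqP: u0; apply: row3P.
- have /rowP/(_ 2) := no (delta_mx 0 1); rewrite crossE !mxE /=.
  by rewrite mulr1 mulr0 subr0.
- have /rowP/(_ 0) := no (delta_mx 0 2); rewrite crossE !mxE /=.
  by rewrite mulr1 mulr0 subr0.
- have /rowP/(_ 1) := no (delta_mx 0 0); rewrite crossE !mxE /=.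
  by rewrite mulr1 mulr0 subr0.
Qed.

(** By genericity: the new planes avoid finitely many lines of the plane u. *)
Lemma extend_transversal u (s : seq 'rV[K]_3) n :
  u != 0 -> {in s, forall f, cross u f != 0} ->
  pairwise (fun f g => det3 u f g != 0) s ->
  exists s', [/\ size s' = n, {in s' ++ s, forall f, cross u f != 0} &
                 pairwise (fun f g => det3 u f g != 0) (s' ++ s)].
Proof.
move=> u0 su sp; elim: n => [|n [s' [sz s'u s'p]]]; first by exists [::].
have [e ue] := exists_cross_neq0 u0.
have [f hf] : exists f, {in cross u e :: [seq cross u g | g <- s' ++ s],
                         forall v, dot v f != 0}.
  apply: (generic_vector charK) => v; rewrite inE => /orP[/eqP ->//|/mapP[g gs ->]].
  exact: s'u.
exists (f :: s'); split; first by rewrite /= sz.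
  move=> g; rewrite /= inE => /orP[/eqP ->|]; last exact: s'u.
  have := hf (cross u e) (mem_head _ _); apply: contraNneq => uf.
  have [x ->] := cross_eq0P u0 uf.
  by rewrite dotZr dotC dot_crossl mulr0.
rewrite /= s'p andbT; apply/allP => g gs.
have := hf (cross u g); rewrite inE map_f ?orbT // => /(_ isT).
by rewrite -[dot _ _]/(det3 u g f) det3_cycle det3C -det3_cycle oppr_eq0 -det3_cycle.
Qed.

Lemma dim_common_kernel (W : vectType K) (V : {vspace W}) (s : seq 'Hom(W, K^o)) :
  exists V' : {vspace W}, [/\ (V' <= V)%VS,
    forall x, x \in V' -> {in s, forall l : 'Hom(W, K^o), l x = 0} &
    (\dim V <= \dim V' + size s)%N].
Proof.
elim: s => [|l s [V' [VV' kV' dV']]].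
  by exists V; split=> //; rewrite addn0.
exists (V' :&: lker l)%VS; split.
- exact: subv_trans (capvSl _ _) VV'.
- move=> x; rewrite memv_cap memv_ker => /andP[xV' /eqP lx] l'.
  by rewrite inE => /orP[/eqP ->//|]; apply: kV'.
have l1 : (\dim (l @: V') <= 1)%N by rewrite (leq_trans (dimvS (subvf _))) ?dimvf.
have := limg_ker_dim l V'; rewrite /=; lia.
Qed.

Variable k : nat.

(** Vector fields of degree k whose first coefficient does not involve the first
    variable: they form a complement to the multiples of the radial field. *)
Definition fields : vectType K := (dhomog 2 K k * dhomog 3 K k * dhomog 3 K k)%type.

Definition field_vec (x : fields) : 'rV[{mpoly K[3]}]_3 :=
  \row_j if j == 0 then mpoly_of_dhomog x.1.1 \mPo [tuple 'X_1; 'X_2]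
         else if j == 1 then mpoly_of_dhomog x.1.2 else mpoly_of_dhomog x.2.

Lemma dim_fields : \dim {:fields} = (k.+1 * k.+3)%N.
Proof.
rewrite dimvf -[LHS]/('C(k + 1, k) + 'C(k + 2, k) + 'C(k + 2, k))%N.
have -> : 'C(k + 1, k) = k.+1 by rewrite addn1 binSn.
have -> : 'C(k + 2, k) = 'C(k + 2, 2) by rewrite -[LHS]bin_sub ?leq_addr // addKn.
have := bin_ffact k.+2 2; rewrite ffactnSr ffactn1 addn2 subSS subn0 2!factS fact0.
lia.
Qed.

Lemma field_vecD x y : field_vec (x + y) = field_vec x + field_vec y.
Proof.
apply/rowP => j; rewrite !mxE.
by case: ifP => _; rewrite ?comp_mpolyD //; case: ifP.
Qed.

Lemma field_vecZ z x : field_vec (z *: x) = z%:MP *: field_vec x.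
Proof.
apply/rowP => j; rewrite !mxE mul_mpolyC.
by case: ifP => _; rewrite ?comp_mpolyZ //; case: ifP.
Qed.

Lemma field_vec_homog x j : field_vec x 0 j \is k.-homog.
Proof.
rewrite mxE; case: ifP => _; last by case: ifP => _; apply: dhomog_is_dhomog.
apply: comp_linear_homog => [|i]; first exact: dhomog_is_dhomog.
by rewrite (tnth_nth 0); case: i => [[|[|//]] ?] /=; rewrite dhomogX /= mdeg1.
Qed.

(** If X x theta = 0, setting the first variable to 0 in the equation
    X_1 theta_0 = X_0 theta_1 kills theta_0, and then the other coefficients. *)
Lemma field_vec_nonradial x : cross (varvec K) (field_vec x) = 0 -> x = 0.
Proof.
move=> xx; have X0 : 'X_0 != 0 :> {mpoly K[3]} by rewrite -msize_poly_eq0 msizeX.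
have X1 : 'X_0 != 0 :> {mpoly K[2]} by rewrite -msize_poly_eq0 msizeX.
have /rowP/(_ 2) := xx; have /rowP/(_ 1) := xx.
rewrite !crossE !mxE /=.
set p := mpoly_of_dhomog x.1.1; set t := [tuple _; _].
set s := [tuple 0; 'X_0; 'X_1 : {mpoly K[2]}].
have compK (q : {mpoly K[2]}) : (q \mPo t) \mPo s = q.
  rewrite (comp_mpolyEX q t) raddf_sum /= [RHS]mpolyE; apply: eq_bigr => m _.
  rewrite comp_mpolyZ comp_mpolyX rmorph_prod /= [in RHS]mpolyXE_id; congr (_ *: _).
  apply: eq_bigr => i _; rewrite rmorphXn /= (tnth_nth 0); congr (_ ^+ _).
  by case: i => [[|[|//]] hi] /=; rewrite comp_mpolyXU /=; congr 'X_ _; apply: val_inj.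
move=> e1 /eqP; rewrite subr_eq0 => /eqP e2.
have p0 : p = 0.
  have := congr1 (comp_mpoly s) e2.
  rewrite !rmorphM /= !comp_mpolyXU /= compK mul0r => /esym/eqP.
  by rewrite mulf_eq0 (negPf X1) => /eqP.
move: e1 e2; rewrite p0 comp_mpoly0 !mulr0 sub0r => /eqP.
rewrite oppr_eq0 mulf_eq0 (negPf X0) => /eqP x2 /eqP.
rewrite mulf_eq0 (negPf X0) => /eqP x1.
by case: x @p p0 x1 x2 {xx} => [[? ?] ?] /= p0 x1 x2;
  congr (_, _, _); apply: val_inj.
Qed.

Definition tangent_along u (t : 'rV[{mpoly K[3]}]_3) :=
  forall v, dot u v = 0 -> dot u (evalvec t v) = 0.

Lemma tangency_functional u v :
  exists l : 'Hom(fields, K^o), forall x, l x = dot u (evalvec (field_vec x) v).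
Proof.
have lin : linear (fun x => dot u (evalvec (field_vec x) v) : K^o).
  move=> z x y; rewrite field_vecD field_vecZ.
  rewrite [LHS](_ : _ = dot u (z *: evalvec (field_vec x) v + evalvec (field_vec y) v)).
    by rewrite dotDr dotZr.
  by congr (dot _ _); apply/rowP => j; rewrite !mxE mevalD mevalM mevalC.
pose g := GRing.isLinear.Build _ _ _ _ _ lin.
pose h : {linear fields -> K^o} :=
  HB.pack (fun x => dot u (evalvec (field_vec x) v) : K^o) g.
by exists (linfun h) => x; rewrite lfunE.
Qed.

Variables (T : finType) (a : T -> 'rV[K]_3).
Hypotheses (ha : pairwise_indep a) (lin : linear_triples (concurrent a)).

(** The planes are added one at a time. Tangency to a plane amounts to k + 1
    linear conditions, imposed at distinct lines of it. A field tangent to two of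
    the previous planes is tangent to the new one along the line they share with
    it, so that each triple completed by the new plane saves one condition. *)
Lemma tangent_fields (B : {set T}) :
  {in B, forall i, valency (concurrent a) B i <= k.+1}%N ->
  exists V : {vspace fields},
    (forall x, x \in V -> {in B, forall i, tangent_along (a i) (field_vec x)}) /\
    (k.+1 * k.+3 + #|triples (concurrent a) B| <= \dim V + #|B| * k.+1)%N.
Proof.
move: {2}#|B| (leqnn #|B|) => n; elim: n B => [|n ih] B Bn val.
  exists fullv; rewrite dim_fields; split.
    by move=> x _ i iB; move: Bn; rewrite leqn0 (cards_eq0) => /eqP B0; move: iB; rewrite B0 inE.
  rewrite (_ : #|triples _ _| = 0)%N ?addn0 ?leq_addr //; apply/eqP.
  rewrite cards_eq0; apply/eqP/setP => X; rewrite inE [RHS]inE; apply/negbTE.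
  rewrite negb_and -implybE; apply/implyP => XB; apply/negP => /andP[/eqP X3 _].
  by have := subset_leq_card XB; rewrite X3; move: Bn; lia.
have [B0|/set0Pn[i iB]] := eqVneq B set0.
  by apply: ih => //; rewrite B0 cards0.
have sB := subsetDl B [set i].
have cB := cardsD1 i B; rewrite iB add1n in cB.
have [||V [tV dV]] := ih (B :\ i); first by rewrite -ltnS -cB.
  move=> j jB; apply: leq_trans (val j (subsetP sB j jB)).
  exact: valencyS.
(* The planes of [s] cut out on the plane i the lines where tangency is free. *)
pose s := [seq a (other_member i X) | X <- enum (triples_through (concurrent a) B i)].
have mem_s X : X \in triples_through (concurrent a) B i ->
    exists j l, [/\ other_member i X = j, X = [set i; j; l],
                    [/\ j \in B :\ i & l \in B :\ i],
                    i != j /\ j != l & concurrent a i j l].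
  rewrite mem_through => /andP[XB iX].
  have : other_member i X \in X :\ i.
    by apply: other_memberP; move: XB; rewrite inE => /and3P[_ /eqP -> _].
  have [j [l [XE [_ jB lB] [ij il jl] cijl]]] := tripleP XB iX.
  rewrite {2}XE !inE => /andP[/negPf -> /= /orP[]/eqP e].
    exists j, l; split=> //.
    by rewrite !inE jB lB !(eq_sym _ i) ij il.
  exists l, j; split=> //.
  - by rewrite XE setUAC.
  - by rewrite !inE jB lB !(eq_sym _ i) ij il.
  - by split; rewrite // eq_sym.
  - by rewrite concurrentC concurrent_cycle.
have s_indep : {in s, forall f, cross (a i) f != 0}.
  move=> _ /mapP[X + ->]; rewrite mem_enum => /mem_s[j [l [-> _ _ [ij _] _]]].
  exact: ha.2.
have s_pw : pairwise (fun f g => det3 (a i) f g != 0) s.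
  rewrite pairwise_map.
  have := enum_uniq (mem (triples_through (concurrent a) B i)); rewrite uniq_pairwise.
  apply: (@sub_in_pairwise _ (mem (triples_through (concurrent a) B i))); last first.
    by apply/allP => X; rewrite mem_enum.
  move=> X Y XB YB /= XY; apply/negP => c.
  have toT Z : Z \in triples_through (concurrent a) B i ->
      Z \in triples (concurrent a) setT.
    by rewrite mem_through => /andP[ZB _]; apply: (subsetP (triplesS _ (subsetT B))).
  have [j [l [jE XE [jB lB] [ij jl] _]]] := mem_s X XB.
  have [j' [l' [jE' YE [jB' lB'] [ij' jl'] _]]] := mem_s Y YB.
  rewrite jE jE' in c; case/eqP: XY.
  have [jj|jj] := eqVneq j j'.
    by apply: (@lin X Y i j) => //; rewrite ?toT // ?XE ?YE ?jj !inE ?eqxx ?orbT.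
  have ZT : [set i; j; j'] \in triples (concurrent a) setT by apply: set3_triple.
  transitivity [set i; j; j'].
    by apply: (@lin _ _ i j) => //; rewrite ?toT // ?XE !inE ?eqxx ?orbT.
  by apply: (@lin _ _ i j') => //; rewrite ?toT // ?YE !inE ?eqxx ?orbT.
have [s' [sz s'u s'p]] :=
  extend_transversal (k.+1 - valency (concurrent a) B i) (ha.1 i) s_indep s_pw.
have lE v : exists l : 'Hom(fields, K^o),
  forall x, l x = dot (a i) (evalvec (field_vec x) v) by apply: tangency_functional.
have [l {}lE] := choice lE.
(* Tangency remains to be imposed at k + 1 - valency further lines. *)
have [V' [V'V kV dV']] := dim_common_kernel V [seq l (cross (a i) f) | f <- s'].
exists V'; split; last first.
  rewrite (card_triplesD1 _ B i) cB; move: dV' dV (val i iB).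
  by rewrite size_map sz; lia.
move=> x xV j jB; have [->|ji] := eqVneq j i; last first.
  by apply: tV; rewrite ?(subvP V'V) // !inE ji.
have hp : dot (cstvec (a i)) (field_vec x) \is k.-homog.
  apply: rpred_sum => m _; rewrite mxE mul_mpolyC rpredZ //; exact: field_vec_homog.
have pE v : (dot (cstvec (a i)) (field_vec x)).@[v 0]
            = dot (a i) (evalvec (field_vec x) v).
  by rewrite meval_dot evalvec_cst.
have : vanishes_on (a i) (dot (cstvec (a i)) (field_vec x)).
  apply: (plane_vanish charK s'u s'p hp); last first.
    rewrite size_cat sz size_map -cardE -/(valency _ _ _) subnK ?ltnSn //.
    exact: val.
  move=> f; rewrite mem_cat pE => /orP[fs'|].
    by rewrite -lE; apply: (kV x xV); apply: (map_f (fun f => l (cross (a i) f))).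
  move=> /mapP[X + ->]; rewrite mem_enum => /mem_s[m [m' [-> _ [mB mB'] [im mm] c]]].
  have tm := tV x (subvP V'V _ xV) m mB _ (dot_crossr (a i) (a m)).
  have cv : dot (a m') (cross (a i) (a m)) = 0.
    by rewrite det3_dot -det3_cycle; apply/eqP; move: c; rewrite /concurrent det3_cycle.
  have tm' := tV x (subvP V'V _ xV) m' mB' _ cv.
  apply: (det3_eq0_dot (ha.2 _ _ mm) _ tm tm'); apply/eqP.
  by move: c; rewrite concurrent_cycle.
by move=> h v /h; rewrite pE.
Qed.

End DimensionCount.

Section MinimalDegree.

Variable K : fieldType.
Hypothesis charK : [pchar K] =i pred0.
Variables (T : finType) (a : T -> 'rV[K]_3).
Hypotheses (ha : pairwise_indep a) (lin : linear_triples (concurrent a)).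
Implicit Types (C : {set T}).

(** In degree k = #|C| - 4 the fields have dimension (k + 1) (k + 3), and tangency
    imposes (k + 4) (k + 1) conditions, less one for each triple: this leaves a
    nonzero field as soon as there are k + 2 triples. *)
Lemma core_log_form C :
  (5 <= #|C|)%N -> (#|C| <= #|triples (concurrent a) C| + 2)%N ->
  has_log_form a C (#|C| - 3).
Proof.
move=> C5 Cn; pose k := (#|C| - 4)%N.
have [|V [tV dV]] := @tangent_fields _ charK k _ a ha lin C.
  by move=> i iC; have := valency_lt lin iC; move: C5; rewrite /k; lia.
have V0 : V != 0%VS.
  by rewrite -dimv_eq0; move: dV C5 Cn; rewrite /k; nia.
exists (cross (varvec K) (field_vec (vpick V))); last first.
  by apply: contraNneq V0 => /field_vec_nonradial /eqP; rewrite vpick0.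
have -> : (#|C| - 3 = k.+1)%N by move: C5; rewrite /k; lia.
split=> [j||i iC v iv].
- rewrite mxE -(add1n k) rpredB //; apply: dhomogM; rewrite ?field_vec_homog //.
    by rewrite mxE dhomogX /= mdeg1.
  by rewrite mxE dhomogX /= mdeg1.
- exact: dot_crossl.
rewrite evalvec_cross evalvec_var double_cross [dot v _]dotC iv scale0r sub0r.
by rewrite dotC (tV _ (memv_pick V) i iC v iv) scale0r oppr0.
Qed.

(** The constant field v is tangent to the planes that contain v. *)
Lemma pencil_log_form C v :
  v != 0 -> {in C, forall i, dot (a i) v = 0} -> has_log_form a C 1.
Proof.
move=> v0 Cv; exists (cross (varvec K) (cstvec v)); last first.
  have [u vu] := exists_cross_neq0 v0; apply: contraNneq vu => w0.
  by rewrite crossC -{1}(evalvec_var u) -(evalvec_cst v u) -evalvec_cross w0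
     [evalvec 0 u](_ : _ = 0) ?oppr0 //; apply/rowP => j; rewrite !mxE meval0.
split=> [j||i iC p ip].
- rewrite mxE rpredB // !mxE mulrC mul_mpolyC rpredZ // dhomogX /= mdeg1 //.
- exact: dot_crossl.
rewrite evalvec_cross evalvec_var evalvec_cst double_cross.
by rewrite [dot p _]dotC ip [dot v _]dotC Cv // !scale0r subr0.
Qed.

(** The bound of [log_form_degree_ge] is attained by enlarging two planes, three
    concurrent ones or a core, according to the defect. *)
Theorem log_form_degreeP m :
  (1 < #|T|)%N -> (#|triples (concurrent a) setT| <= 5)%N ->
  has_log_form a setT m.+1 <-> (#|T| <= m + 2 + defect (concurrent a) setT)%N.
Proof.
move=> T2 n5; split=> [/(log_form_degree_ge charK ha lin n5)|le].
  by rewrite cardsT; lia.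
suff [C [e [CT hC eC]]] : exists C e,
    [/\ C \subset setT, has_log_form a C e & (e + (#|T| - #|C|) <= m.+1)%N].
  apply: has_log_form_le (has_log_form_add ha.1 CT hC); by rewrite cardsT.
move: le; rewrite /defect; have [_|/set0Pn[X XT]] := eqVneq (triples _ _) set0.
  move=> le; have /card_gt1P[i [j [_ _ ij]]] : (1 < #|[set: T]|)%N by rewrite cardsT.
  exists [set i; j], 1%N; split; first exact: subsetT; last by rewrite cards2 ij; lia.
  apply: (pencil_log_form (ha.2 i j ij)) => l; rewrite !inE => /orP[]/eqP ->.
    exact: dot_crossl.
  exact: dot_crossr.
case: existsP => [[C /andP[CT cC]]|_] le.
  have nC := leq_trans (subset_leq_card (triplesS (concurrent a) CT)) n5.
  have [C5 Cn] := core_card lin nC cC.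
  exists C, (#|C| - 3)%N; split=> //; first exact: core_log_form.
  by have := subset_leq_card CT; rewrite cardsT; lia.
have /set0Pn[i iX] : X != set0.
  by apply: contraTneq XT => ->; rewrite inE cards0 !andbF.
have [j [l [XE _ [ij _ _] c]]] := tripleP XT iX.
exists X, 1%N; split; first exact: subsetT; last first.
  by move: XT; rewrite inE => /and3P[_ /eqP -> _]; lia.
apply: (pencil_log_form (ha.2 i j ij)) => p; rewrite XE !inE -orbA.
case/or3P => /eqP ->; rewrite ?dot_crossl ?dot_crossr //.
by rewrite det3_dot det3_cycle; apply/eqP.
Qed.

End MinimalDegree.

(** * Line arrangements and their intersection lattices *)

Section Arrangement.

Variable K : fieldType.
Hypothesis charK : [pchar K] =i pred0.
Variable A : line_arrangement K.

Definition normal (i : 'I_(nlines A)) : 'rV[K]_3 := \row_j (Defs.form i)@_U_(j).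

Lemma form_normal i : Defs.form i = linform (normal i).
Proof.
apply/mpolyP => m; have [/eqP/mdeg1P[j /eqP ->]|m1] := eqVneq (mdeg m) 1%N.
  by rewrite mcoeff_linform mxE.
rewrite (dhomog_nemf_coeff (form_linear i) m1).
by rewrite (dhomog_nemf_coeff (linform_homog _) m1).
Qed.

Lemma normal_indep : pairwise_indep normal.
Proof.
have n0 i : normal i != 0 by rewrite -linform_eq0 -form_normal form_neq0.
split=> // i j ij; apply/eqP => /(cross_eq0P (n0 i))[x nj].
have /eqP[] : Defs.form j != x *: Defs.form i by apply: form_nonprop; rewrite eq_sym.
rewrite !form_normal nj /linform scaler_sumr; apply: eq_bigr => k _.
by rewrite mxE scalerA.
Qed.

Lemma mem_line i v : (v \in line i) = (dot (normal i) v == 0).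
Proof. by rewrite mem_zero_line ?form_linear // form_normal meval_linform. Qed.

Lemma defining_polyE : defining_poly A = plane_product normal.
Proof. by apply: eq_bigr => i _; rewrite form_normal. Qed.

Lemma mdr_leP k : (0 < nlines A)%N ->
  (mdr A <= k)%N <-> has_log_form normal setT k.+1.
Proof.
move=> A0; have T0 : (0 < #|'I_(nlines A)|)%N by rewrite card_ord.
rewrite /mdr; case: ex_minnP => m /asboolP hm mmin; split=> [mk|hk].
  move: hm; rewrite defining_polyE => /(log_form_of_syzygy charK normal_indep T0).
  exact: has_log_form_le.
apply: mmin; apply/asboolP; rewrite defining_polyE.
exact: (syzygy_of_log_form charK normal_indep T0).
Qed.

Definition lines_at (p : {vspace 'rV[K]_3}) := [set i : 'I_(nlines A) | (p <= line i)%VS].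

Lemma lines_at_vline v i : (i \in lines_at <[v]>%VS) = (dot (normal i) v == 0).
Proof. by rewrite inE -memvE mem_line. Qed.

Lemma dim1_vline (p : {vspace 'rV[K]_3}) :
  \dim p = 1%N -> exists2 v, v != 0 & p = <[v]>%VS.
Proof.
move=> p1; exists (vpick p); first by rewrite vpick0 -dimv_eq0 p1.
apply/esym/eqP; rewrite eqEdim p1 dim_vline vpick0 -dimv_eq0 p1.
by rewrite -memvE memv_pick.
Qed.

Lemma lines_at_concurrent v i j k : v != 0 ->
  i \in lines_at <[v]>%VS -> j \in lines_at <[v]>%VS -> k \in lines_at <[v]>%VS ->
  concurrent normal i j k.
Proof.
rewrite !lines_at_vline => v0 /eqP vi /eqP vj /eqP vk.
by apply: contraNT v0 => c; rewrite (dot3_eq0 c vi vj vk).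
Qed.

Lemma subset_triple_lines_at X i j : X \in triples (concurrent normal) setT ->
  i \in X -> j \in X -> i != j ->
  X \subset lines_at <[cross (normal i) (normal j)]>%VS.
Proof.
rewrite inE => /and3P[_ _ /forall_inP cX] iX jX ij; apply/subsetP => k kX.
have /forall_inP/(_ j jX)/forall_inP/(_ k kX) := cX i iX.
by rewrite lines_at_vline det3_dot /concurrent det3_cycle det3_cycle => /eqP ->.
Qed.

Lemma vline_cross_dim i j : i != j -> \dim <[cross (normal i) (normal j)]>%VS = 1%N.
Proof. by move=> ij; rewrite dim_vline (normal_indep.2 i j ij). Qed.

(** Two concurrent triples with two common lines lie over the same point, which
    has multiplicity at least 4 if they differ. *)
Lemma linear_triplesP :
  only_double_triple_points A <-> linear_triples (concurrent normal).
Proof.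
split=> [h X Y i j XT YT ij iX jX iY jY|lin p p1].
  set S := lines_at <[cross (normal i) (normal j)]>%VS.
  have S3 : (#|S| <= 3)%N := h _ (vline_cross_dim ij).
  have eqS Z : Z \in triples (concurrent normal) setT -> i \in Z -> j \in Z -> Z = S.
    move=> ZT iZ jZ; apply/eqP; rewrite eqEcard subset_triple_lines_at //.
    by move: ZT; rewrite inE => /and3P[_ /eqP -> _].
  by rewrite (eqS X) // (eqS Y).
rewrite leqNgt; apply/negP => S4.
have [v v0 pE] := dim1_vline p1.
have S2 : (2 < #|lines_at p|)%N by apply: ltnW.
have /card_gt2P[i [j [k [[iS jS kS] [ij jk ki]]]]] := S2.
have tr l : l \in lines_at p -> l != i -> l != j ->
    [set i; j; l] \in triples (concurrent normal) setT.
  move=> lS li lj; apply: set3_triple; rewrite ?inE // 1?eq_sym //.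
  by apply: (@lines_at_concurrent v); rewrite // -pE.
have [l lS ln] : exists2 l, l \in lines_at p & l \notin [set i; j; k].
  apply/subsetPn; apply: contraL S4 => /subset_leq_card le.
  rewrite -leqNgt (leq_trans le) // setUC cardsU1 cards2.
  by case: (_ \notin _); case: (_ != _).
move: ln; rewrite !inE !negb_or => /andP[/andP[li lj] lk].
have eXY : [set i; j; k] = [set i; j; l].
  have kj : k != j by rewrite eq_sym.
  have := tr k kS ki kj; have := tr l lS li lj => T1 T2.
  by apply: (@lin _ _ i j) => //; rewrite !inE eqxx ?orbT.
have : l \in [set i; j; k] by rewrite eXY !inE eqxx !orbT.
by rewrite !inE (negPf li) (negPf lj) (negPf lk).
Qed.

Lemma lines_at_triple (p : {vspace 'rV[K]_3}) : \dim p = 1%N -> mult A p = 3%N ->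
  lines_at p \in triples (concurrent normal) setT.
Proof.
move=> /dim1_vline[v v0 ->] m3; rewrite inE subsetT -[#|_|]/(mult _ _) m3 eqxx /=.
apply/forall_inP => i iS; apply/forall_inP => j jS; apply/forall_inP => k kS.
exact: (lines_at_concurrent v0).
Qed.

Lemma lines_at_inj (p p' : {vspace 'rV[K]_3}) : \dim p = 1%N -> \dim p' = 1%N ->
  (1 < #|lines_at p|)%N -> lines_at p = lines_at p' -> p = p'.
Proof.
move=> /dim1_vline[v v0 ->] /dim1_vline[v' v'0 ->] /card_gt1P[i [j [iS jS ij]]] e.
have := iS; have := jS; rewrite e; move: iS jS; rewrite !lines_at_vline.
move=> /eqP vi /eqP vj /eqP v'j /eqP v'i; have c := normal_indep.2 i j ij.
have vline (u : 'rV[K]_3) : u != 0 -> dot (normal i) u = 0 -> dot (normal j) u = 0 ->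
    <[u]>%VS = <[cross (normal i) (normal j)]>%VS.
  move=> u0 ui uj; have [x uE] := dot2_eq0P c ui uj.
  apply/eqP; rewrite eqEdim !dim_vline u0 c andbT -memvE uE memvZ ?memv_line //.
by rewrite (vline v) // (vline v').
Qed.

(** A triple point corresponds to the set of the three lines through it. *)
Lemma triple_pointsP n : only_double_triple_points A ->
  has_npoints A 3 n <-> #|triples (concurrent normal) setT| = n.
Proof.
move=> dt; split=> [[s [us <- hs]]|<-].
  have ms p : p \in s -> \dim p = 1%N /\ mult A p = 3%N.
    by rewrite hs => /andP[/eqP-> /eqP->].
  rewrite cardE -(size_map lines_at); apply/perm_size/uniq_perm.
  - exact: enum_uniq.
  - rewrite map_inj_in_uniq // => p p' /ms[p1 p3] /ms[p1' _]; apply: lines_at_inj => //.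
    by rewrite -[#|_|]/(mult _ _) p3.
  move=> X; rewrite mem_enum; apply/idP/mapP => [XT|[p /ms[p1 p3] ->]]; last first.
    exact: lines_at_triple.
  have X3 : #|X| = 3%N by move: XT; rewrite inE => /and3P[_ /eqP].
  have /card_gt1P[i [j [iX jX ij]]] : (1 < #|X|)%N by rewrite X3.
  have p1 := vline_cross_dim ij.
  exists <[cross (normal i) (normal j)]>%VS; last first.
    by apply/eqP; rewrite eqEcard subset_triple_lines_at // X3 dt.
  have := subset_leq_card (subset_triple_lines_at XT iX jX ij).
  by rewrite X3 hs p1 eqxx eqn_leq dt.
have pt X : exists p, X \in triples (concurrent normal) setT ->
    \dim p = 1%N /\ lines_at p = X.
  have [XT|_] := boolP (X \in _); last by exists 0%VS.
  have X3 : #|X| = 3%N by move: XT; rewrite inE => /and3P[_ /eqP].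
  have /card_gt1P[i [j [iX jX ij]]] : (1 < #|X|)%N by rewrite X3.
  have p1 := vline_cross_dim ij.
  exists <[cross (normal i) (normal j)]>%VS => _; split=> //.
  by apply/esym/eqP; rewrite eqEcard subset_triple_lines_at // X3 dt.
have [f hf] := choice pt.
exists [seq f X | X <- enum (triples (concurrent normal) setT)]; split.
- rewrite map_inj_in_uniq ?enum_uniq // => X Y; rewrite !mem_enum => XT YT e.
  by rewrite -(hf X XT).2 -(hf Y YT).2 e.
- by rewrite size_map -cardE.
move=> p; apply/mapP/andP => [[X + ->]|[/eqP p1 /eqP p3]].
  rewrite mem_enum => XT; have [-> e] := hf X XT; split=> //.
  by rewrite -[mult _ _]/#|lines_at _| e; move: XT; rewrite inE => /and3P[_ /eqP ->].
have pT := lines_at_triple p1 p3.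
exists (lines_at p); first by rewrite mem_enum.
have [f1 fE] := hf _ pT; apply: lines_at_inj => //.
by rewrite -[#|_|]/(mult _ _) p3.
Qed.

(** * Flats and isomorphisms *)

Definition flat_of (B : {set 'I_(nlines A)}) := (\bigcap_(i in B) line i)%VS.

Lemma mem_flat_of B v :
  (v \in flat_of B) = [forall i in B, dot (normal i) v == 0].
Proof.
rewrite memvE; apply/subv_bigcapP/forall_inP => h i iB.
  by rewrite -mem_line memvE h.
by rewrite -memvE mem_line h.
Qed.

Lemma flat_ofP B : flat_of B \in flats A.
Proof. by rewrite mem_undup; apply: codom_f. Qed.

Definition mkflat B : intersection_lattice A := SeqSub (flat_ofP B).

Lemma flatP (X : intersection_lattice A) : exists B, X = mkflat B.
Proof.
have := ssvalP X; rewrite mem_undup => /codomP[B XE].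
by exists B; apply: val_inj.
Qed.

Lemma flat_of_lines_at B : flat_of (lines_at (flat_of B)) = flat_of B.
Proof.
apply: subv_anti; apply/andP; split; last first.
  by apply/subv_bigcapP => i; rewrite inE.
apply/subv_bigcapP => i iB; apply: (@bigcapv_inf _ _ _ i); rewrite ?subvv // inE.
by apply: (@bigcapv_inf _ _ _ i).
Qed.

(** A flat is the intersection of the lines that contain it. *)
Lemma flat_leE (X Y : intersection_lattice A) :
  flat_le X Y = (lines_at (ssval X) \subset lines_at (ssval Y)).
Proof.
apply/idP/subsetP => [XY i|XY].
  by rewrite !inE; apply: subv_trans.
have [B XE] := flatP X; rewrite /flat_le XE /= -flat_of_lines_at.
by apply/subv_bigcapP => i iX; have := XY i; rewrite XE !inE => ->//; move: iX; rewrite inE.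
Qed.

End Arrangement.

Section Atoms.

Variable K : fieldType.
Variable A : line_arrangement K.
Implicit Types (X Y Z : intersection_lattice A) (i j k : 'I_(nlines A)).

Definition line_flat i : intersection_lattice A := mkflat [set i].

Lemma line_flatE i : ssval (line_flat i) = line i.
Proof. by rewrite /= /flat_of big_set1. Qed.

Lemma dim_line i : (\dim (line i) < 3)%N.
Proof.
rewrite ltnNge; apply/negP => d3.
have [n an] := exists_dot1 ((normal_indep A).1 i).
have : n \in line i.
  rewrite (_ : line i = fullv) ?memvf //; apply/eqP.
  by rewrite eqEdim subvf dimvf /dim /= mul1n.
by rewrite mem_line an oner_eq0.
Qed.

Lemma line_sub i j : (line i <= line j)%VS -> i = j.
Proof.
move=> ij; apply/eqP; apply: contraT => /((normal_indep A).2 i j)/eqP[].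
apply: vanishes_linform => v iv; rewrite meval_linform; apply/eqP.
by rewrite -mem_line; apply: (subvP ij); rewrite mem_line iv.
Qed.

Lemma line_flat_inj : injective line_flat.
Proof.
by move=> i j e; apply: line_sub; rewrite -!line_flatE e.
Qed.

(** An order-theoretic description of the atoms that does not name the bottom
    element, and so is visibly invariant under isomorphisms. *)
Definition is_atom X :=
  (exists2 Z, Z != X & flat_le Z X) /\
  (forall Y, Y != X -> flat_le Y X -> forall Z, flat_le Y Z).

Definition full_flat : intersection_lattice A := mkflat set0.

Lemma full_flatE : ssval full_flat = fullv.
Proof. by rewrite /= /flat_of big_set0. Qed.

Lemma flat_cases X : X = full_flat \/ exists i, flat_le (line_flat i) X.
Proof.
have [B ->] := flatP X; have [->|/set0Pn[i iB]] := eqVneq B set0; first by left.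
by right; exists i; rewrite /flat_le line_flatE; apply: (@bigcapv_inf _ _ _ i).
Qed.

Lemma flat_le_anti X Y : flat_le X Y -> flat_le Y X -> X = Y.
Proof.
by move=> XY YX; apply: val_inj; apply: subv_anti; rewrite /= (YX : (_ <= _)%VS).
Qed.

Lemma line_flat_neq_full i : line_flat i != full_flat.
Proof.
apply: contraTneq (dim_line i) => e.
by rewrite -line_flatE e full_flatE dimvf /dim.
Qed.

Lemma is_atomP X : is_atom X <-> exists i, X = line_flat i.
Proof.
have le_full Z : flat_le full_flat Z by rewrite /flat_le full_flatE subvf.
split=> [[[Z ZX leZ] Xmin]|[i ->]]; last first.
  split; first by exists full_flat; rewrite // eq_sym line_flat_neq_full.
  move=> Y Yi leY; have [->//|[j jY]] := flat_cases Y.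
  have ji : j = i.
    apply/esym/line_sub; rewrite -!line_flatE; exact: subv_trans leY jY.
  by case/eqP: Yi; apply: flat_le_anti; rewrite // -ji.
have [Xf|[i iX]] := flat_cases X.
  by case/eqP: ZX; apply: flat_le_anti; rewrite // Xf.
exists i; apply/eqP; apply: contraT; rewrite eq_sym => iNX.
have := Xmin _ iNX iX full_flat => leif; case/eqP: (line_flat_neq_full i).
exact: flat_le_anti.
Qed.

(** The common point of the lines i and j is the least flat above both; concurrency
    means that the line k contains it, that is, lies below it in the lattice. *)
Lemma concurrent_flat i j k : i != j ->
  concurrent (@normal K A) i j k <->
  forall Z, flat_le (line_flat i) Z -> flat_le (line_flat j) Z -> flat_le (line_flat k) Z.
Proof.
move=> ij; have c := (normal_indep A).2 i j ij; split=> [/eqP cijk Z|h].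
  rewrite /flat_le !line_flatE => Zi Zj; apply/subvP => v vZ; rewrite mem_line.
  have := subvP Zi v vZ; have := subvP Zj v vZ; rewrite !mem_line => /eqP vj /eqP vi.
  by rewrite (det3_eq0_dot c cijk vi vj).
pose Z := mkflat [set i; j].
have inZ l : l \in [set i; j] -> flat_le (line_flat l) Z.
  by move=> lij; rewrite /flat_le line_flatE; apply: (@bigcapv_inf _ _ _ l).
have := h Z (inZ i _) (inZ j _); rewrite !inE !eqxx orbT => /(_ isT isT).
rewrite /flat_le line_flatE => /subvP /(_ (cross (normal i) (normal j))).
rewrite mem_line det3_dot det3_cycle; apply; rewrite mem_flat_of.
by apply/forall_inP => l; rewrite !inE => /orP[]/eqP ->; rewrite ?dot_crossl ?dot_crossr.
Qed.

End Atoms.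

Definition preserves_concurrency (T1 T2 : finType) (c1 : T1 -> T1 -> T1 -> bool)
    (c2 : T2 -> T2 -> T2 -> bool) (f : T1 -> T2) :=
  injective f /\ forall i j k, c2 (f i) (f j) (f k) = c1 i j k.

Lemma lattice_isomorphic_sym (K : fieldType) (A1 A2 : line_arrangement K) :
  lattice_isomorphic A1 A2 -> lattice_isomorphic A2 A1.
Proof.
move=> [phi [psi phiK psiK] mphi]; exists psi; first by exists phi.
by move=> X Y; rewrite -mphi !psiK.
Qed.

(** The lines are the atoms of the lattice, and concurrency is expressed in terms
    of its order. *)
Lemma lattice_isomorphic_lines (K : fieldType) (A1 A2 : line_arrangement K) :
  lattice_isomorphic A1 A2 ->
  exists f, preserves_concurrency (concurrent (@normal K A1)) (concurrent (@normal K A2)) f.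
Proof.
move=> [phi [psi phiK psiK] mphi].
have mpsi X Y : flat_le (psi X) (psi Y) = flat_le X Y by rewrite -mphi !psiK.
have fE i : exists j, phi (line_flat i) = line_flat j.
  have [[Z Zi leZ] imin] := (is_atomP (line_flat i)).2 (ex_intro _ i erefl).
  apply/is_atomP; split.
    by exists (phi Z); rewrite ?(can_eq phiK) // mphi.
  move=> Y Yi leY Z'; rewrite -mpsi; apply: imin; last by rewrite -mphi psiK.
  by apply: contraNneq Yi => <-; rewrite psiK.
have [f {}fE] := choice fE; exists f.
have finj : injective f.
  move=> i j e; apply: (@line_flat_inj _ A1); apply: (can_inj phiK).
  by rewrite !fE e.
split=> // i j k; have [->|ij] := eqVneq i j; first by rewrite !concurrent_self.
have fij : f i != f j by rewrite (inj_eq finj).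
apply/idP/idP => [/(concurrent_flat _ fij) h|/(concurrent_flat _ ij) h].
  by apply/concurrent_flat => // Z Zi Zj; rewrite -mphi fE; apply: h; rewrite -fE mphi.
apply/concurrent_flat => // Z; rewrite -!fE -[Z]psiK !mphi; exact: h.
Qed.

Section Transport.

Variables (T1 T2 : finType) (c1 : T1 -> T1 -> T1 -> bool) (c2 : T2 -> T2 -> T2 -> bool).
Variable f : T1 -> T2.
Hypothesis hf : preserves_concurrency c1 c2 f.
Implicit Types (B X : {set T1}).

Lemma imset_triples B X : (f @: X \in triples c2 (f @: B)) = (X \in triples c1 B).
Proof.
have [finj fc] := hf; rewrite !inE card_imset //.
have -> : (f @: X \subset f @: B) = (X \subset B).
  apply/subsetP/subsetP => [h x xX|h _ /imsetP[x xX ->]].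
    by have := h _ (imset_f f xX); rewrite mem_imset.
  by rewrite imset_f ?h.
congr [&& _, _ & _]; apply/forall_inP/forall_inP => h i iX; apply/forall_inP => j jX;
  apply/forall_inP => k kX.
  have /forall_inP/(_ _ (imset_f f jX))/forall_inP/(_ _ (imset_f f kX)) := h _ (imset_f f iX).
  by rewrite fc.
case/imsetP: iX jX kX => i' iX -> /imsetP[j' jX ->] /imsetP[k' kX ->]; rewrite fc.
by have /forall_inP/(_ _ jX)/forall_inP/(_ _ kX) := h _ iX.
Qed.

Lemma triples_imset B : triples c2 (f @: B) = [set f @: X | X : {set T1} in triples c1 B].
Proof.
apply/setP => Y; apply/idP/imsetP => [YB|[X XB ->]]; last by rewrite imset_triples.
have YE : Y = f @: (f @^-1: Y).
  apply/setP => y; apply/idP/imsetP => [yY|[x]]; last by rewrite inE => ? ->.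
  have : y \in f @: B by move: YB; rewrite inE => /and3P[/subsetP/(_ y yY)].
  by case/imsetP => x xB yE; exists x; rewrite // inE -yE.
by exists (f @^-1: Y); rewrite // -imset_triples -YE.
Qed.

Lemma card_triples_imset B : #|triples c2 (f @: B)| = #|triples c1 B|.
Proof. by rewrite triples_imset card_imset //; apply: imset_inj; case: hf. Qed.

Lemma valency_imset B i : valency c2 (f @: B) (f i) = valency c1 B i.
Proof.
have [finj _] := hf; rewrite /valency -(card_imset _ (imset_inj finj)).
apply: eq_card => Y; rewrite mem_through triples_imset.
apply/andP/imsetP => [[/imsetP[X XB ->] iX]|[X]].
  by exists X; rewrite // mem_through XB -(mem_imset _ _ finj).
by rewrite mem_through => /andP[XB iX] ->; rewrite !imset_f.
Qed.

Lemma defect_transport : (defect c1 setT <= defect c2 setT)%N.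
Proof.
rewrite /defect; have [//|/set0Pn[X XT]] := eqVneq (triples c1 setT) set0.
have XT2 : f @: X \in triples c2 setT.
  by apply: (subsetP (triplesS c2 (subsetT (f @: setT)))); rewrite imset_triples.
have [e|_] := eqVneq (triples c2 setT) set0; first by rewrite e inE in XT2.
case: existsP => [[C /andP[_ /andP[C0 /forall_inP cC]]]|_]; last by case: ifP.
case: existsP => // -[]; exists (f @: C); rewrite subsetT /= /is_core.
rewrite imset_eq0 C0; apply/forall_inP => _ /imsetP[i iC ->].
by rewrite valency_imset cC.
Qed.

End Transport.

(** The minimal degree is a function of the number of lines and the defect, which
    an isomorphism of lattices cannot lower, nor its inverse. *)
Theorem mdr_combinatorial (K : fieldType) (charK : [pchar K] =i pred0)
    (A1 A2 : line_arrangement K) n3 :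
  (1 < nlines A1)%N -> (1 < nlines A2)%N ->
  only_double_triple_points A1 -> only_double_triple_points A2 ->
  has_npoints A1 3 n3 -> has_npoints A2 3 n3 -> (n3 <= 5)%N ->
  lattice_isomorphic A1 A2 -> mdr A1 = mdr A2.
Proof.
move=> A1_2 A2_2 dt1 dt2 /(triple_pointsP _ dt1) n1 /(triple_pointsP _ dt2) n2 n5 iso.
have [f hf] := lattice_isomorphic_lines iso.
have [g hg] := lattice_isomorphic_lines (lattice_isomorphic_sym iso).
have ef : nlines A1 = nlines A2.
  have := leq_card f hf.1; have := leq_card g hg.1; rewrite !card_ord; lia.
have df : defect (concurrent (@normal K A1)) setT = defect (concurrent (@normal K A2)) setT.
  by apply/eqP; rewrite eqn_leq (defect_transport hf) (defect_transport hg).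
have mle A : (1 < nlines A)%N -> only_double_triple_points A ->
    (#|triples (concurrent (@normal K A)) setT| <= 5)%N -> forall k,
    (mdr A <= k)%N = (nlines A <= k + 2 + defect (concurrent (@normal K A)) setT)%N.
  move=> A2' dtA nA k; apply/idP/idP => [/(mdr_leP charK _ (ltnW A2'))|h].
    move=> /(log_form_degreeP charK (normal_indep A) ((linear_triplesP A).1 dtA)).
    by rewrite card_ord; apply.
  apply/(mdr_leP charK _ (ltnW A2')).
  apply/(log_form_degreeP charK (normal_indep A) ((linear_triplesP A).1 dtA)) => //.
    by rewrite card_ord.
  by rewrite card_ord.
have m1 := mle A1 A1_2 dt1; have m2 := mle A2 A2_2 dt2; rewrite n1 in m1; rewrite n2 in m2.
apply/eqP; rewrite eqn_leq; apply/andP; split.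
  by rewrite (m1 n5) df ef -(m2 n5).
by rewrite (m2 n5) -df -ef -(m1 n5).
Qed.

(** * Arrangements from families of vectors *)

Section Realization.

Variable K : fieldType.
Variable n : nat.
Implicit Types (a : 'I_n -> 'rV[K]_3).

Lemma linformZ (x : K) u : x *: linform u = linform (x *: u).
Proof.
rewrite /linform scaler_sumr; apply: eq_bigr => j _.
by rewrite mxE scalerA.
Qed.

Lemma linform_inj : injective (@linform K).
Proof. by move=> u v e; apply/rowP => j; rewrite -!mcoeff_linform e. Qed.

Lemma linform_nonprop a : pairwise_indep a ->
  forall i j, i != j -> forall x : K, linform (a i) != x *: linform (a j).
Proof.
move=> ha i j ij x; rewrite linformZ; apply/eqP => /linform_inj e.
by have := ha.2 i j ij; rewrite e crossZl cross_self scaler0 eqxx.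
Qed.

Definition arrangement_of a (ha : pairwise_indep a) : line_arrangement K :=
  @LineArrangement K n (fun i => linform (a i)) (fun i => linform_homog (a i))
    (fun i => etrans (congr1 negb (linform_eq0 (a i))) (ha.1 i)) (linform_nonprop ha).

Lemma normal_arrangement_of a (ha : pairwise_indep a) :
  @normal K (arrangement_of ha) = a.
Proof.
by apply/funext => i; apply/rowP => j; rewrite mxE mcoeff_linform.
Qed.

Definition closed_under a (B : {set 'I_n}) i :=
  forall v, {in B, forall j, dot (a j) v = 0} -> dot (a i) v = 0.

(** The planes of B meet in the whole space, a plane, a line or 0, and concurrency
    tells which: it therefore determines the planes that contain their
    intersection. *)
Lemma closed_under_transfer a1 a2 B i :
  pairwise_indep a1 -> pairwise_indep a2 -> concurrent a1 = concurrent a2 ->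
  closed_under a1 B i -> closed_under a2 B i.
Proof.
move=> h1 h2 c12 cl v Bv; have [B0|/set0Pn[j jB]] := eqVneq B set0.
  have [u u1] := exists_dot1 (h1.1 i).
  have : dot (a1 i) u = 0 by apply: cl => k; rewrite B0 inE.
  by rewrite u1 => /eqP; rewrite oner_eq0.
have [/exists_inP[l lB lj]|] := boolP [exists l in B, l != j]; last first.
  rewrite negb_exists_in => /forall_inP Bj; suff -> : i = j by apply: Bv.
  apply/eqP; apply: contraT; rewrite eq_sym => /h1.2/eqP[].
  apply: vanishes_linform => u ju; rewrite meval_linform; apply: cl => k kB.
  by have := Bj k kB; rewrite negbK => /eqP ->.
rewrite eq_sym in lj.
have [/exists_inP[m mB c]|] := boolP [exists m in B, ~~ concurrent a1 j l m].
  rewrite c12 in c.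
  by rewrite (dot3_eq0 c (Bv j jB) (Bv l lB) (Bv m mB)) dot0r.
rewrite negb_exists_in => /forall_inP Bjl.
have cjl : concurrent a1 j l i.
  rewrite /concurrent /det3 dotC; apply/eqP; apply: cl => k kB; rewrite dotC.
  by have := Bjl k kB; rewrite negbK => /eqP.
rewrite c12 in cjl.
exact: det3_eq0_dot (h2.2 j l lj) (eqP cjl) (Bv j jB) (Bv l lB).
Qed.

Lemma lines_at_flat_of a (ha : pairwise_indep a) (B : {set 'I_n}) i :
  i \in lines_at (arrangement_of ha) (@flat_of K (arrangement_of ha) B) <-> closed_under a B i.
Proof.
rewrite inE; split=> [/subvP h v Bv|cl].
  have := h v; rewrite mem_flat_of mem_line normal_arrangement_of => h'.
  by apply/eqP/h'/forall_inP => j jB; rewrite Bv.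
apply/subvP => v; rewrite mem_flat_of mem_line normal_arrangement_of => /forall_inP h.
by apply/eqP/cl => j jB; apply/eqP/h.
Qed.

(** A flat of either arrangement is determined by the set of lines through it,
    and the same sets occur for both. *)
Lemma lattice_isomorphic_of a1 a2 (h1 : pairwise_indep a1) (h2 : pairwise_indep a2) :
  concurrent a1 = concurrent a2 ->
  lattice_isomorphic (arrangement_of h1) (arrangement_of h2).
Proof.
move=> c12.
have key (b1 b2 : 'I_n -> 'rV[K]_3) (k1 : pairwise_indep b1) (k2 : pairwise_indep b2) :
    concurrent b1 = concurrent b2 -> forall X : intersection_lattice (arrangement_of k1),
    lines_at (arrangement_of k2)
      (ssval (@mkflat K (arrangement_of k2) (lines_at (arrangement_of k1) (ssval X))))
    = lines_at (arrangement_of k1) (ssval X).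
  move=> e X; have [B ->] := flatP X; have eB := @flat_of_lines_at K (arrangement_of k1) B.
  apply/setP => i; rewrite /= -{2}eB.
  apply/idP/idP => /lines_at_flat_of cl; apply/lines_at_flat_of;
    exact: closed_under_transfer cl.
pose phi (X : intersection_lattice (arrangement_of h1)) :=
  @mkflat K (arrangement_of h2) (lines_at (arrangement_of h1) (ssval X)).
pose psi (X : intersection_lattice (arrangement_of h2)) :=
  @mkflat K (arrangement_of h1) (lines_at (arrangement_of h2) (ssval X)).
exists phi; last by move=> X Y; rewrite !flat_leE !(key _ _ h1 h2).
exists psi => X; have [B XE] := flatP X; apply: val_inj; rewrite /= /flat_of.
  by have := key _ _ h1 h2 c12 X; rewrite /phi => ->; rewrite XE; apply: flat_of_lines_at.
by have := key _ _ h2 h1 (esym c12) X; rewrite /psi => ->; rewrite XE; apply: flat_of_lines_at.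
Qed.

End Realization.

(** * Adding a line through a double point *)

Section Extension.

Variable K : fieldType.
Hypothesis charK : [pchar K] =i pred0.

Definition extend n (a : 'I_n -> 'rV[K]_3) (u : 'rV[K]_3) (k : 'I_n.+1) :=
  if unlift ord_max k is Some l then a l else u.

Definition double_point n (a : 'I_n -> 'rV[K]_3) i j :=
  i != j /\ forall k, concurrent a i j k -> k = i \/ k = j.

Definition through_double n (a : 'I_n -> 'rV[K]_3) i j u :=
  [/\ u != 0, forall k, cross (a k) u != 0 &
      forall k l, k != l ->
        (det3 (a k) (a l) u == 0) = (k == i) && (l == j) || (k == j) && (l == i)].

(** The planes through the double point are normal to the combinations of [a i]
    and [a j]; each of the other intersections excludes one of them. *)
Lemma exists_through_double n (a : 'I_n -> 'rV[K]_3) i j :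
  pairwise_indep a -> double_point a i j -> exists u, through_double a i j u.
Proof.
move=> ha [ij dij].
pose bad k l := (k == i) && (l == j) || (k == j) && (l == i).
(* [D (k, l)] is the linear form, in the first two coordinates x and y of a vector,
   expressing that x (a i) + y (a j) is concurrent with k and l. *)
pose D (kl : 'I_n * 'I_n) : 'rV[K]_3 :=
  det3 (a kl.1) (a kl.2) (a i) *: delta_mx 0 0 + det3 (a kl.1) (a kl.2) (a j) *: delta_mx 0 1.
have Ddot kl (v : 'rV[K]_3) :
    dot (D kl) v = det3 (a kl.1) (a kl.2) (v 0 0 *: a i + v 0 1 *: a j).
  rewrite /D dotDl !dotZl /det3 dotDr !dotZr [v 0 0 * _]mulrC [v 0 1 * _]mulrC.
  by congr (_ * _ + _ * _); rewrite dotE !mxE /=; ring.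
pose s : seq 'rV[K]_3 := delta_mx 0 0 :: delta_mx 0 1 ::
  [seq D kl | kl <- enum {: 'I_n * 'I_n} & (kl.1 != kl.2) && ~~ bad kl.1 kl.2].
have [v hv] : exists v, {in s, forall f, dot f v != 0}.
  apply: (generic_vector charK) => f; rewrite !inE => /or3P[/eqP ->|/eqP ->|].
  - by apply/eqP => /rowP/(_ 0)/eqP; rewrite !mxE eqxx oner_eq0.
  - by apply/eqP => /rowP/(_ 1)/eqP; rewrite !mxE eqxx oner_eq0.
  move=> /mapP[[k l]]; rewrite mem_filter => /andP[/andP[/= kl nbad] _] ->.
  apply/eqP => D0.
  have ci : dot (a i) (cross (a k) (a l)) = 0.
    have := Ddot (k, l) (delta_mx 0 0); rewrite D0 dotC dot0r !mxE /= scale1r scale0r addr0.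
    by move=> e; rewrite det3_dot det3_cycle -e.
  have cj : dot (a j) (cross (a k) (a l)) = 0.
    have := Ddot (k, l) (delta_mx 0 1); rewrite D0 dotC dot0r !mxE /= scale1r scale0r add0r.
    by move=> e; rewrite det3_dot det3_cycle -e.
  have [x xE] := dot2_eq0P (ha.2 i j ij) ci cj.
  have x0 : x != 0 by apply: contraNneq (ha.2 k l kl) => x0; rewrite xE x0 scale0r.
  have conc m : dot (a m) (cross (a k) (a l)) = 0 -> m = i \/ m = j.
    move=> cm; apply: dij; rewrite /concurrent det3_cycle det3_cycle -det3_dot.
    by move: cm; rewrite xE dotZr => /eqP; rewrite mulf_eq0 (negPf x0).
  have := conc k (dot_crossl _ _); have := conc l (dot_crossr _ _).
  move: nbad kl; rewrite /bad; move=> nb kl [] lE [] kE; move: nb kl;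
    by rewrite lE kE ?eqxx ?orbT.
have v0 : v 0 0 != 0.
  have := hv (delta_mx 0 0); rewrite inE eqxx => /(_ isT).
  by rewrite dotE !mxE /= mul1r !mul0r !addr0.
have v1 : v 0 1 != 0.
  have := hv (delta_mx 0 1); rewrite !inE eqxx orbT => /(_ isT).
  by rewrite dotE !mxE /= mul1r !mul0r addr0 add0r.
pose u := v 0 0 *: a i + v 0 1 *: a j.
have cu k : cross (a k) u != 0.
  have [->|ki] := eqVneq k i.
    rewrite crossDr !crossZr cross_self scaler0 add0r scaler_eq0 negb_or v1.
    exact: ha.2.
  have [->|kj] := eqVneq k j.
    rewrite crossDr !crossZr cross_self scaler0 addr0 scaler_eq0 negb_or v0.
    by apply: ha.2; rewrite eq_sym.
  apply/eqP => ku; have : concurrent a i j k.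
    have [x uE] := cross_eq0P (ha.1 k) ku.
    have x0 : x != 0.
      apply: contraNneq (ha.2 i j ij) => x0; have : cross (a i) u = 0 by rewrite uE x0 scale0r cross0r.
      rewrite crossDr !crossZr cross_self scaler0 add0r => /eqP.
      by rewrite scaler_eq0 (negPf v1).
    have : det3 (a i) (a j) u = 0.
      by rewrite /det3 dotDr !dotZr ![dot (cross _ _) _]dotC dot_crossl dot_crossr !mulr0 addr0.
    by rewrite uE /det3 dotZr => /eqP; rewrite mulf_eq0 (negPf x0).
  by case/dij => e; [case/eqP: ki|case/eqP: kj].
exists u; split=> // [|k l kl]; first exact: (cross_neq0_neq0 (cu i)).2.
rewrite -/(bad k l); have [b|nb] := boolP (bad k l).
  apply/eqP; case/orP: b => /andP[/eqP -> /eqP ->].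
    by rewrite /det3 dotDr !dotZr ![dot (cross _ _) _]dotC dot_crossl dot_crossr !mulr0 addr0.
  by rewrite /det3 dotDr !dotZr ![dot (cross _ _) _]dotC dot_crossl dot_crossr !mulr0 addr0.
apply/negbTE; rewrite -(Ddot (k, l)); apply: hv; rewrite !inE; apply/orP; right.
by apply/orP; right; apply: map_f; rewrite mem_filter /= kl nb mem_enum.
Qed.

Section OneFamily.

Variables (n : nat) (a : 'I_n -> 'rV[K]_3) (i j : 'I_n) (u : 'rV[K]_3).
Hypotheses (ha : pairwise_indep a) (dij : double_point a i j).
Hypothesis (hu : through_double a i j u).

Let b := extend a u.
Let f := lift (@ord_max n).

Lemma extend_lift k : b (f k) = a k.
Proof. by rewrite /b /extend liftK. Qed.

Lemma extend_max : b ord_max = u.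
Proof. by rewrite /b /extend unlift_none. Qed.

Lemma ord_maxVlift (k : 'I_n.+1) : k = ord_max \/ exists l, k = f l.
Proof. by case: (unliftP ord_max k) => [l ->|->]; [right; exists l|left]. Qed.

Lemma extend_indep : pairwise_indep b.
Proof.
have [u0 cu _] := hu; split=> [k|k l].
  by have [->|[m ->]] := ord_maxVlift k; rewrite ?extend_max ?extend_lift //; apply: ha.1.
have [->|[k' ->]] := ord_maxVlift k; have [->|[l' ->]] := ord_maxVlift l;
  rewrite ?eqxx // ?extend_max ?extend_lift // => kl.
  by rewrite crossC oppr_eq0.
by apply: ha.2; apply: contraNneq kl => ->.
Qed.

Lemma extend_preserves : preserves_concurrency (concurrent a) (concurrent b) f.
Proof.
by split=> [|k l m]; [exact: lift_inj|rewrite /concurrent !extend_lift].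
Qed.

Lemma imset_lift_max : f @: setT = setT :\ ord_max.
Proof.
apply/setP => k; rewrite !inE andbT; apply/imsetP/idP => [[l _ ->]|km].
  by rewrite eq_sym neq_lift.
by have [e|[l ->]] := ord_maxVlift k; [rewrite e eqxx in km|exists l].
Qed.

Let Xnew := [set ord_max; f i; f j].

Lemma Xnew_triple : Xnew \in triples (concurrent b) setT.
Proof.
have [ij _] := dij; have [_ _ du] := hu.
apply: set3_triple; rewrite ?inE ?neq_lift ?(inj_eq lift_inj) //.
rewrite concurrent_cycle /concurrent !extend_lift extend_max du //.
by rewrite !eqxx.
Qed.

Lemma triple_through_new X : X \in triples (concurrent b) setT -> ord_max \in X -> X = Xnew.
Proof.
move=> XT mX; have [p [q [-> _ [mp mq pq] c]]] := tripleP XT mX.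
have [e|[k pk]] := ord_maxVlift p; first by rewrite e eqxx in mp.
have [e|[l ql]] := ord_maxVlift q; first by rewrite e eqxx in mq.
subst p q; have kl : k != l by apply: contraNneq pq => ->.
have [_ _ du] := hu; move: c.
rewrite concurrent_cycle /concurrent !extend_lift extend_max du //.
by case/orP => /andP[/eqP -> /eqP ->] //; rewrite /Xnew setUAC.
Qed.

Lemma extend_valency : valency (concurrent b) setT ord_max = 1%N.
Proof.
rewrite /valency (_ : triples_through _ _ _ = [set Xnew]) ?cards1 //.
apply/setP => X; rewrite mem_through in_set1; apply/andP/eqP => [[]|->].
  exact: triple_through_new.
by rewrite Xnew_triple !inE eqxx.
Qed.

Lemma extend_card_triples :
  #|triples (concurrent b) setT| = #|triples (concurrent a) setT|.+1.
Proof.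
rewrite (card_triplesD1 _ _ ord_max) extend_valency -imset_lift_max addn1.
by rewrite (card_triples_imset extend_preserves).
Qed.

Lemma triple_old X : X \in triples (concurrent b) setT -> ord_max \notin X ->
  exists2 Y, Y \in triples (concurrent a) setT & X = f @: Y.
Proof.
move=> XT mX; have : X \in triples (concurrent b) (f @: setT).
  move: XT; rewrite !inE imset_lift_max => /and3P[_ cX aX]; apply/and3P; split=> //.
  by apply/subsetP => k kX; rewrite !inE andbT; apply: contraNneq mX => <-.
by rewrite (triples_imset extend_preserves) => /imsetP[Y YT ->]; exists Y.
Qed.

Lemma extend_linear : linear_triples (concurrent a) -> linear_triples (concurrent b).
Proof.
have [ij di] := dij => lin.
have mixed X Y p q : X \in triples (concurrent b) setT ->
    Y \in triples (concurrent b) setT -> p != q ->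
    p \in X -> q \in X -> p \in Y -> q \in Y -> ord_max \in X -> ord_max \in Y.
  move=> XT YT pq pX qX pY qY mX; apply: contraT => mY.
  have [Z ZT YE] := triple_old YT mY; rewrite (triple_through_new XT mX) in pX qX.
  have inj := mem_imset _ _ (@lift_inj _ (@ord_max n)).
  have notmax r : r \in Y -> r != ord_max by move=> rY; apply: contraNneq mY => <-.
  have := notmax p pY; have := notmax q qY.
  have iZjZ : i \in Z /\ j \in Z.
    move: pX qX pq; rewrite /Xnew !inE (negPf (notmax p pY)) (negPf (notmax q qY)) /=.
    case/orP => /eqP pE; case/orP => /eqP qE; move: pY qY; rewrite YE pE qE !inj;
      by move=> pZ qZ; rewrite ?eqxx // => _; split.
  have [k [l [ZE _ [ik il kl] c]]] := tripleP ZT iZjZ.1.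
  have : j \in [set i; k; l] by rewrite -ZE iZjZ.2.
  rewrite !inE eq_sym (negPf ij) => /orP[]/eqP jE; subst j.
    by case: (di l c) => e; [rewrite e eqxx in il|rewrite e eqxx in kl].
  have c' : concurrent a i l k by rewrite concurrentC concurrent_cycle.
  by case: (di k c') => e; [rewrite e eqxx in ik|rewrite e eqxx in kl].
move=> X Y p q XT YT pq pX qX pY qY.
have [mX|mX] := boolP (ord_max \in X).
  rewrite (triple_through_new XT mX) (triple_through_new YT) //.
  exact: (mixed X Y p q).
have mY : ord_max \notin Y by apply: contra mX; apply: (mixed Y X p q).
have [X' XT' XE] := triple_old XT mX; have [Y' YT' YE] := triple_old YT mY.
subst X Y; case/imsetP: pX pq pY => p' pX -> pq pY.
case/imsetP: qX pq qY => q' qX -> pq qY.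
have inj := mem_imset _ _ (@lift_inj _ (@ord_max n)).
have pq' : p' != q' by apply: contraNneq pq => ->.
by suff -> : X' = Y' by []; apply: (@lin _ _ p' q'); rewrite // -inj.
Qed.

Lemma extend_double k : k != i -> k != j -> double_point b (f k) ord_max.
Proof.
move=> ki kj; have [_ _ du] := hu; split; first by rewrite eq_sym neq_lift.
move=> l; have [->|[m ->]] := ord_maxVlift l; first by right.
move=> c; left; move: c; have [->//|mk] := eqVneq m k.
rewrite 2!concurrent_cycle /concurrent !extend_lift extend_max du //.
by rewrite (negPf ki) (negPf kj) !andbF.
Qed.

Lemma has_log_form_lift m : has_log_form b (setT :\ ord_max) m <-> has_log_form a setT m.
Proof.
rewrite -imset_lift_max; split=> [[w [hw xw lw] w0]|[w [hw xw lw] w0]]; exists w => //.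
  by split=> // k _; rewrite -extend_lift; apply: lw; apply: imset_f.
by split=> // _ /imsetP[k _ ->]; rewrite extend_lift; apply: lw.
Qed.

Lemma extend_has_log_form m : has_log_form a setT m -> has_log_form b setT m.+1.
Proof. by move=> /has_log_form_lift; apply: has_log_formS; case: extend_indep. Qed.

(** The new line contains a single triple point, so that it can be deleted. *)
Lemma extend_has_log_form_inv m :
  (m.+2 < n)%N -> has_log_form b setT m.+1 -> has_log_form a setT m.
Proof.
move=> mn h; apply/has_log_form_lift.
have [] := log_form_delete charK extend_indep (in_setT (@ord_max n)) _ h => //.
by rewrite cardsT card_ord extend_valency addn1; lia.
Qed.

End OneFamily.

Lemma extend_concurrent_eq n (a1 a2 : 'I_n -> 'rV[K]_3) i j u1 u2 :
  concurrent a1 = concurrent a2 ->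
  through_double a1 i j u1 -> through_double a2 i j u2 ->
  concurrent (extend a1 u1) = concurrent (extend a2 u2).
Proof.
move=> c12 [_ _ d1] [_ _ d2].
have d12 k l : (det3 (a1 k) (a1 l) u1 == 0) = (det3 (a2 k) (a2 l) u2 == 0).
  by have [->|kl] := eqVneq k l; rewrite ?det3uu // d1 // d2.
have cycle2 (u v w : 'rV[K]_3) : det3 u v w = det3 w u v by rewrite -det3_cycle.
apply/funext => p; apply/funext => q; apply/funext => r; rewrite /concurrent /extend.
case: (unlift _ p) => [p'|]; case: (unlift _ q) => [q'|]; case: (unlift _ r) => [r'|].
- by have := congr1 (fun c => c p' q' r') c12.
- exact: d12.
- by rewrite (cycle2 (a1 p')) (cycle2 (a2 p')) d12.
- by rewrite (det3_cycle (a1 p')) (det3_cycle (a2 p')) !det3uu.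
- by rewrite (det3_cycle u1) (det3_cycle u2) d12.
- by rewrite (cycle2 u1) (cycle2 u2) !det3uu.
- by rewrite !det3uu.
- by rewrite !det3uu.
Qed.

(** A counterexample to combinatorial invariance, together with a double point,
    through which a further line can be drawn. *)
Definition lattice_twins n t := exists a1 a2 : 'I_n -> 'rV[K]_3, exists i j,
  [/\ pairwise_indep a1 /\ pairwise_indep a2,
      concurrent a1 = concurrent a2,
      linear_triples (concurrent a1) /\ #|triples (concurrent a1) setT| = t,
      double_point a1 i j &
      ~ has_log_form a1 setT (n - 3) /\ has_log_form a2 setT (n - 3)].

(** The new line meets the lines that miss the chosen double point in further
    double points, with which the construction can be continued. *)
Lemma lattice_twinsS n t : (3 < n)%N -> lattice_twins n t -> lattice_twins n.+1 t.+1.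
Proof.
move=> n3 [a1 [a2 [i [j [[h1 h2] c12 [lin ct] dij [no yes]]]]]].
have dij2 : double_point a2 i j by move: dij; rewrite /double_point c12.
have [u1 hu1] := exists_through_double h1 dij.
have [u2 hu2] := exists_through_double h2 dij2.
have [k ki kj] : exists2 k, k != i & k != j.
  have : (0 < #|~: [set i; j]|)%N.
    have := cardsC [set i; j]; rewrite cards2 card_ord dij.1; lia.
  by move=> /card_gt0P[k]; rewrite !inE negb_or => /andP[ki kj]; exists k.
exists (extend a1 u1), (extend a2 u2), (lift ord_max k), ord_max.
have nE : (n.+1 - 3 = (n - 3).+1)%N by lia.
split; rewrite ?nE.
- by split; [apply: extend_indep hu1|apply: extend_indep hu2].
- exact: extend_concurrent_eq c12 hu1 hu2.
- by split; [apply: extend_linear hu1 lin|rewrite (extend_card_triples dij hu1) ct].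
- exact: extend_double hu1 _ ki kj.
split; last exact: extend_has_log_form hu2 _ yes.
by move=> /(extend_has_log_form_inv h1 dij hu1)/no; apply; lia.
Qed.

Lemma lattice_twins_mdr n t : (3 < n)%N -> lattice_twins n t ->
  exists A1 A2 : line_arrangement K,
  [/\ (1 < nlines A1)%N /\ (1 < nlines A2)%N,
      only_double_triple_points A1 /\ only_double_triple_points A2,
      has_npoints A1 3 t /\ has_npoints A2 3 t,
      lattice_isomorphic A1 A2 & mdr A1 <> mdr A2].
Proof.
move=> n3 [a1 [a2 [i [j [[h1 h2] c12 [lin ct] _ [no yes]]]]]].
exists (arrangement_of h1), (arrangement_of h2).
have dt1 : only_double_triple_points (arrangement_of h1).
  by apply/linear_triplesP; rewrite normal_arrangement_of.
have dt2 : only_double_triple_points (arrangement_of h2).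
  by apply/linear_triplesP; rewrite normal_arrangement_of -c12.
split=> //.
- by rewrite /=; lia.
- split; apply/triple_pointsP => //; rewrite normal_arrangement_of //.
  by rewrite -c12.
- exact: lattice_isomorphic_of.
move=> e; apply: no; have nE : (n - 3 = (n - 4).+1)%N by lia.
have n0 : (0 < n)%N by lia.
have := (@mdr_leP _ charK (arrangement_of h1) (n - 4) n0).1.
rewrite normal_arrangement_of -nE; apply; rewrite e.
by apply: (@mdr_leP _ charK (arrangement_of h2) (n - 4) n0).2; rewrite normal_arrangement_of -nE.
Qed.

End Extension.

(** * First order behaviour at a triple point *)

Section Holonomy.

Variable K : fieldType.
Hypothesis charK : [pchar K] =i pred0.
Implicit Types (p q r : {mpoly K[3]}) (a f g u v P : 'rV[K]_3).
Implicit Types (w : 'rV[{mpoly K[3]}]_3).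

Definition dirderiv p P v : K := \sum_j v 0 j * (p^`M(j)).@[P 0].

Definition dirderiv_vec w P v : 'rV[K]_3 := \row_l dirderiv (w 0 l) P v.

Lemma dirderivM p q P v :
  dirderiv (p * q) P v = dirderiv p P v * q.@[P 0] + p.@[P 0] * dirderiv q P v.
Proof.
rewrite /dirderiv mulr_suml mulr_sumr -big_split; apply: eq_bigr => j _ /=.
by rewrite mderivM mevalD !mevalM; ring.
Qed.

Lemma dirderivD p q P v : dirderiv (p + q) P v = dirderiv p P v + dirderiv q P v.
Proof.
rewrite /dirderiv -big_split; apply: eq_bigr => j _ /=.
by rewrite mderivD mevalD mulrDr.
Qed.

Lemma dirderivZ x p P v : dirderiv (x *: p) P v = x * dirderiv p P v.
Proof.
rewrite /dirderiv mulr_sumr; apply: eq_bigr => j _.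
by rewrite mderivZ mevalZ mulrCA.
Qed.

Lemma dirderiv_linform f P v : dirderiv (linform f) P v = dot f v.
Proof.
by apply: eq_bigr => j _; rewrite mderiv_linform mevalC mulrC.
Qed.

Lemma dirderiv_vanish a p P v : a != 0 -> vanishes_on a p ->
  dot a P = 0 -> dot a v = 0 -> dirderiv p P v = 0.
Proof.
move=> a0 /(vanishes_divides charK a0)[q ->] aP av.
by rewrite dirderivM dirderiv_linform meval_linform av aP !mul0r addr0.
Qed.

Lemma dirderiv_vecD w P u v :
  dirderiv_vec w P (u + v) = dirderiv_vec w P u + dirderiv_vec w P v.
Proof.
apply/rowP => l; rewrite !mxE -big_split; apply: eq_bigr => j _ /=.
by rewrite mxE mulrDl.
Qed.

Lemma dirderiv_vecZ w P x v : dirderiv_vec w P (x *: v) = x *: dirderiv_vec w P v.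
Proof.
apply/rowP => l; rewrite !mxE /dirderiv mulr_sumr; apply: eq_bigr => j _.
by rewrite mxE mulrA.
Qed.

Lemma dirderiv_vec_self w m P :
  (forall l, w 0 l \is m.-homog) -> evalvec w P = 0 -> dirderiv_vec w P P = 0.
Proof.
move=> hw wP; apply/rowP => l; have := congr1 (meval (P 0)) (euler_homog (hw l)).
rewrite mevalMn !mxE raddf_sum /=.
have /rowP/(_ l) := wP; rewrite !mxE => ->; rewrite mul0rn => e; rewrite -[RHS]e.
by apply: eq_bigr => j _; rewrite mevalM mevalXU.
Qed.

Lemma dot_dirderiv_vec w P v :
  dot (varvec K) w = 0 -> evalvec w P = 0 -> dot P (dirderiv_vec w P v) = 0.
Proof.
move=> xw wP.
have wl l : (w 0 l).@[P 0] = 0 by have /rowP/(_ l) := wP; rewrite !mxE.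
have : dirderiv (dot (varvec K) w) P v = 0.
  by rewrite xw /dirderiv big1 // => j _; rewrite mderiv0 meval0 mulr0.
rewrite !dotE !dirderivD !dirderivM !wl !mulr0 !add0r !mxE !mevalXU; apply.
Qed.

(** The derivative of w at P induces a bilinear form on the quotient of the space
    by P, which has dimension 2. The associated quadratic form vanishes on three
    lines, hence is zero: the bilinear form is alternating, and such forms are
    multiples of the determinant. *)
Lemma triple_point_derivative w m P v1 v2 v3 :
  (forall l, w 0 l \is m.-homog) -> dot (varvec K) w = 0 -> evalvec w P = 0 ->
  det3 P v1 v2 != 0 -> det3 P v1 v3 != 0 -> det3 P v2 v3 != 0 ->
  dot v1 (dirderiv_vec w P v1) = 0 -> dot v2 (dirderiv_vec w P v2) = 0 ->
  dot v3 (dirderiv_vec w P v3) = 0 ->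
  exists q : K, forall v, dirderiv_vec w P v = q *: cross P v.
Proof.
move=> hw xw wP d12 d13 d23 h1 h2 h3.
have DP v := dot_dirderiv_vec v xw wP; have D0 := dirderiv_vec_self hw wP.
have cP v v' : det3 P v v' != 0 -> cross P v != 0.
  by apply: contraNneq => c; rewrite /det3 c dotC dot0r.
have swap v v' : det3 P v v' = - det3 P v' v.
  by rewrite -det3_cycle det3C.
have d21 : det3 P v2 v1 != 0 by rewrite swap oppr_eq0.
have d32 : det3 P v3 v2 != 0 by rewrite swap oppr_eq0.
have [q1 e1] := dot2_eq0P (cP _ _ d12) (DP v1) h1.
have [q2 e2] := dot2_eq0P (cP _ _ d21) (DP v2) h2.
have DE v : det3 P v1 v2 *: dirderiv_vec w P v
    = det3 P v v2 *: (q1 *: cross P v1) + det3 P v1 v *: (q2 *: cross P v2).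
  rewrite -dirderiv_vecZ (cramer3 v P v1 v2) !dirderiv_vecD !dirderiv_vecZ.
  by rewrite D0 e1 e2 scaler0 add0r.
have q12 : q1 = q2.
  have : dot (det3 P v1 v2 *: v3) (det3 P v1 v2 *: dirderiv_vec w P v3) = 0.
    by rewrite dotZr dotZl h3 !mulr0.
  rewrite DE (cramer3 v3 P v1 v2).
  set x := det3 v3 v1 v2; set y := det3 P v3 v2 in d32 *; set z := det3 P v1 v3 in d13 *.
  have -> : dot (x *: P + y *: v1 + z *: v2)
      (y *: (q1 *: cross P v1) + z *: (q2 *: cross P v2))
      = y * z * det3 P v1 v2 * (q1 - q2) by vector_ring.
  move/eqP; rewrite !mulf_eq0 (negPf d32) (negPf d13) (negPf d12) /= subr_eq0.
  by move/eqP.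
exists q1 => v; apply: (scalerI d12); rewrite DE -q12; vector_ring.
Qed.

Lemma homog0_const p : p \is 0.-homog -> exists x, p = x%:MP.
Proof.
move=> hp; exists (p@_0%MM); apply/mpolyP => m; rewrite mcoeffC.
have [->|m0] := eqVneq 0%MM m; first by rewrite mulr1.
by rewrite mulr0 (dhomog_nemf_coeff hp) // mdeg_eq0 eq_sym.
Qed.

(** On the plane a, a logarithmic form w is a polynomial multiple of a vanishing
    on m known lines, and m is the degree of w: it is known up to a constant c.
    Here f and [f'] are further planes through P and [P'], and h lists the planes
    meeting a outside of P and [P']. The derivatives of w at P and [P'] are c times
    known numbers, hence the relation between the scalars q and [q'] of these two
    triple points; if one of them is zero, so is c. *)
Lemma edge_relation a f f' (h : seq 'rV[K]_3) w m P P' (q q' : K) :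
  (forall l, w 0 l \is m.-homog) -> size h = (m - 2)%N -> (1 < m)%N ->
  a != 0 -> normal_along a w ->
  {in f :: f' :: h, forall g, normal_along g w} ->
  {in f :: f' :: h, forall g, cross a g != 0} ->
  pairwise (fun g g' => det3 a g g' != 0) [:: f, f' & h] ->
  dot a P = 0 -> dot f P = 0 -> dot a P' = 0 -> dot f' P' = 0 ->
  cross P P' != 0 ->
  (forall v, dirderiv_vec w P v = q *: cross P v) ->
  (forall v, dirderiv_vec w P' v = q' *: cross P' v) ->
  let H v := \prod_(g <- h) dot g v in
  [/\ H P != 0, H P' != 0, q * H P' = - (q' * H P),
      q = 0 -> forall l, vanishes_on a (w 0 l) &
      q' = 0 -> forall l, vanishes_on a (w 0 l)].
Proof.
move=> hw sh m1 a0 na nh ch ph aP fP aP' fP' PP' DP DP' H.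
have [PN0 P'N0] := cross_neq0_neq0 PP'.
have [k ak] := rV3_neq0 a0.
have [c [hc _ cE]] : exists c, [/\ c \is (m - size [:: f, f' & h]).-homog,
    (m < size [:: f, f' & h])%N -> c = 0 & forall v, dot a v = 0 ->
    (w 0 k).@[v 0] = c.@[v 0] * \prod_(g <- [:: f, f' & h]) dot g v].
  apply: plane_factor => // g gs.
  have /rowP/(_ k) := normal_two_planes (ch g gs) (dot_crossl _ _) (dot_crossr _ _)
    na (nh g gs).
  by rewrite !mxE.
have [x cx] : exists x, c = x%:MP.
  by apply: homog0_const; move: hc; rewrite /= sh; congr (_ \is _.-homog); lia.
pose Hp := \prod_(g <- h) linform g.
have HE v : Hp.@[v 0] = H v.
  by rewrite rmorph_prod; apply: eq_bigr => g _; rewrite /= meval_linform.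
pose r := (x / a 0 k) *: (linform f * (linform f' * Hp)).
have rE v : dot a v = 0 -> evalvec w v = r.@[v 0] *: a.
  move=> av; apply/rowP => l; apply: (mulIf ak); rewrite !mxE.
  have wk : evalvec w v 0 k = x * (dot f v * (dot f' v * H v)).
    by rewrite mxE cE // cx mevalC !big_cons.
  have pl := cross_eq0_coord l k (na v av).
  move: pl; rewrite wk [evalvec w v 0 l]mxE => ->.
  by rewrite mevalZ !mevalM !meval_linform HE; field.
have DrE Q v : dot a Q = 0 -> dot a v = 0 ->
    dirderiv_vec w Q v = dirderiv r Q v *: a.
  move=> aQ av; apply/rowP => l; rewrite !mxE.
  have van : vanishes_on a (w 0 l + (- a 0 l) *: r).
    move=> u au; have /rowP/(_ l) := rE u au; rewrite mxE [RHS]mxE => e.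
    by rewrite mevalD (mevalZ (u 0) (- a 0 l) r) e; ring.
  have := dirderiv_vanish a0 van aQ av; rewrite dirderivD dirderivZ.
  by rewrite mulNr => /subr0_eq ->; rewrite mulrC.
have rP : dirderiv r P P' = x / a 0 k * (dot f P' * (dot f' P * H P)).
  by rewrite dirderivZ dirderivM dirderiv_linform meval_linform fP mul0r addr0
    mevalM meval_linform HE.
have rP' : dirderiv r P' P = x / a 0 k * (dot f P' * (dot f' P * H P')).
  rewrite dirderivZ !dirderivM !dirderiv_linform.
  by rewrite mevalM !meval_linform fP' HE; ring.
have := DrE P P' aP aP'; rewrite DP rP => e.
have := DrE P' P aP' aP; rewrite DP' rP' => e'.
have nvan g g' Q : Q != 0 -> dot a Q = 0 -> dot g Q = 0 -> det3 a g g' != 0 ->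
    dot g' Q != 0.
  move=> Q0 aQ gQ d; apply: contraNneq Q0 => g'Q.
  by rewrite (dot3_eq0 d aQ gQ g'Q).
move: ph => /= /andP[/andP[dff' /allP fh] /andP[/allP f'h _]].
have HP0 : H P != 0.
  rewrite prodf_seq_neq0; apply/allP => g gh /=.
  by apply: (nvan f) => //; apply: fh.
have HP'0 : H P' != 0.
  rewrite prodf_seq_neq0; apply/allP => g gh /=.
  by apply: (nvan f') => //; apply: f'h.
have f'P : dot f' P != 0 by apply: (nvan f).
have fP'0 : dot f P' != 0.
  by apply: (nvan f') => //; rewrite -det3_cycle det3C oppr_eq0.
have xvan : x = 0 -> forall l, vanishes_on a (w 0 l).
  move=> x0 l v av; have /rowP/(_ l) := rE v av.
  by rewrite !mxE /r x0 mul0r scale0r meval0 mul0r => ->.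
have kill Q : Q != 0 -> (x / a 0 k * (dot f P' * (dot f' P * Q))) *: a = 0 -> x = 0.
  move=> Q0 /eqP; rewrite scaler_eq0 (negPf a0) orbF !mulf_eq0 invr_eq0.
  by rewrite (negPf ak) (negPf f'P) (negPf fP'0) (negPf Q0) !orbF => /eqP.
split=> //.
- have : (q * H P' + q' * H P) *: cross P P' = 0.
    rewrite scalerDl [q * _]mulrC [q' * _]mulrC -!scalerA e.
    rewrite [cross P P']crossC scalerN e' !scalerA.
    apply/rowP => l; rewrite !mxE; ring.
  by move/eqP; rewrite scaler_eq0 (negPf PP') orbF addr_eq0 => /eqP.
- by move=> q0; apply: xvan; apply: (kill _ HP0); rewrite -e q0 scale0r.
- by move=> q0; apply: xvan; apply: (kill _ HP'0); rewrite -e' q0 scale0r.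
Qed.

End Holonomy.

(** * Nine lines with six triple points *)

(** The examples have integer coordinates. Vectors are given by functions on
    natural numbers, for which determinants can be evaluated by computation. *)

Section IntegerVectors.

Implicit Types (f g h : nat -> int).

Definition zdot f g : int := f 0%N * g 0%N + f 1%N * g 1%N + f 2%N * g 2%N.

Definition zcross f g (j : nat) : int :=
  f ((j + 1) %% 3)%N * g ((j + 2) %% 3)%N - f ((j + 2) %% 3)%N * g ((j + 1) %% 3)%N.

Definition zdet f g h := zdot (zcross f g) h.

Definition znonzero f := [|| f 0%N != 0, f 1%N != 0 | f 2%N != 0].

Variable K : fieldType.
Hypothesis charK : [pchar K] =i pred0.

Definition zrow f : 'rV[K]_3 := \row_j (f j)%:~R.

Lemma intr_char0_eq0 (z : int) : (z%:~R == 0 :> K) = (z == 0).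
Proof.
have nat0 n : (n%:R == 0 :> K) = (n == 0%N) by rewrite ((pcharf0P K).1 charK).
by case: z => n; rewrite ?NegzE ?mulrNz ?oppr_eq0 -?pmulrn nat0.
Qed.

Lemma dot_zrow f g : dot (zrow f) (zrow g) = (zdot f g)%:~R.
Proof. by rewrite dotE !mxE /zdot !rmorphD !rmorphM. Qed.

Lemma cross_zrow f g : cross (zrow f) (zrow g) = zrow (zcross f g).
Proof. by apply: row3P; rewrite crossE !mxE /zcross /= rmorphB !rmorphM. Qed.

Lemma det3_zrow f g h : det3 (zrow f) (zrow g) (zrow h) = (zdet f g h)%:~R.
Proof. by rewrite /det3 cross_zrow dot_zrow. Qed.

Lemma zrow_neq0 f : znonzero f -> zrow f != 0.
Proof.
move=> h; apply/eqP => /rowP f0; move: h; rewrite /znonzero.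
have := f0 0; have := f0 1; have := f0 2; rewrite !mxE /=.
by do 3!(move=> /eqP; rewrite intr_char0_eq0 => /eqP ->).
Qed.

End IntegerVectors.

(** The line of index 3 r + s joins the coordinate point e_s to the point Q_r
    whose coordinates are the inverses of those of u_r. *)
Definition hexline (u : nat -> nat -> int) (i j : nat) : int :=
  if j == ((i + 1) %% 3)%N then u (i %/ 3)%N j
  else if j == ((i + 2) %% 3)%N then - u (i %/ 3)%N j else 0.

Definition coordpoint (s j : nat) : int := (j == s)%:R.

(** The point Q_r, after clearing denominators. *)
Definition invpoint (u : nat -> nat -> int) (r j : nat) : int :=
  u r ((j + 1) %% 3)%N * u r ((j + 2) %% 3)%N.

(** Indices are congruent modulo 3 for the lines through the same e_s, and have
    the same quotient by 3 for those through the same Q_r. *)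
Definition hex_concurrent (i j k : nat) :=
  [|| i == j, i == k, j == k, (i %% 3 == j %% 3)%N && (j %% 3 == k %% 3)%N
    | (i %/ 3 == j %/ 3)%N && (j %/ 3 == k %/ 3)%N].

Definition hex_generic (u : nat -> nat -> int) :=
  all (fun i => all (fun j =>
    ((i != j) ==> znonzero (zcross (hexline u i) (hexline u j))) &&
    all (fun k => (zdet (hexline u i) (hexline u j) (hexline u k) == 0)
                  == hex_concurrent i j k) (iota 0 9)) (iota 0 9)) (iota 0 9).

Definition table (s : seq (seq int)) (r j : nat) : int := nth 0 (nth [::] s r) j.

(** The conics through the e_s are the inverses of lines, so that the six points
    are on a conic when the u_r are linearly dependent. The rows of the first
    table are, their entries having sum 0, but not those of the second. *)
Definition conic_table := table [:: [:: 1; -4; 3]; [:: 1; 1; -2]; [:: 2; -1; -1]].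
Definition nonconic_table := table [:: [:: 1; -1; 1]; [:: 1; 1; 2]; [:: 1; 2; 3]].

Lemma conic_generic : hex_generic conic_table.
Proof. by vm_cast_no_check (erefl true). Qed.

Lemma nonconic_generic : hex_generic nonconic_table.
Proof. by vm_cast_no_check (erefl true). Qed.

Section Hexagon.

Variable K : fieldType.
Hypothesis charK : [pchar K] =i pred0.

Definition hexfamily u (i : 'I_9) : 'rV[K]_3 := zrow K (hexline u i).

Section Generic.

Variable u : nat -> nat -> int.
Hypothesis gen : hex_generic u.

Let a := hexfamily u.

Lemma ord9_iota (i : 'I_9) : (i : nat) \in iota 0 9.
Proof. by rewrite mem_iota add0n ltn_ord. Qed.

Lemma hex_indep : pairwise_indep a.
Proof.
have cr (i j : 'I_9) : i != j -> cross (a i) (a j) != 0.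
  move=> ij; rewrite cross_zrow; apply: (zrow_neq0 charK).
  have /allP/(_ _ (ord9_iota i))/allP/(_ _ (ord9_iota j))/andP[/implyP h _] := gen.
  exact: h.
split=> // i; have [->|i0] := eqVneq i ord0.
  exact: (cross_neq0_neq0 (cr ord0 ord_max isT)).1.
exact: (cross_neq0_neq0 (cr i ord0 i0)).1.
Qed.

Lemma hex_concurrentE i j k : concurrent a i j k = hex_concurrent i j k.
Proof.
rewrite /concurrent det3_zrow intr_char0_eq0 //.
by have /allP/(_ _ (ord9_iota i))/allP/(_ _ (ord9_iota j))/andP[_
  /allP/(_ _ (ord9_iota k))/eqP] := gen.
Qed.

End Generic.

Lemma hex_concurrent_eq u1 u2 : hex_generic u1 -> hex_generic u2 ->
  concurrent (hexfamily u1) = concurrent (hexfamily u2).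
Proof.
by move=> g1 g2; apply/funext => i; apply/funext => j; apply/funext => k; rewrite !hex_concurrentE.
Qed.

Section GenericTriples.

Variable u : nat -> nat -> int.
Hypothesis gen : hex_generic u.

Let a := hexfamily u.

(** The sets of lines through e_0, e_1, e_2, Q_0, Q_1 and Q_2, in this order. *)
Definition hexpoint (t : 'I_6) : {set 'I_9} :=
  [set i : 'I_9 | if (t < 3)%N then (i %% 3 == t)%N else (i %/ 3 == t - 3)%N].

Lemma card_hexpoint t : #|hexpoint t| = 3%N.
Proof.
rewrite -sum1_card big_mkcond /= !big_ord_recl big_ord0 /hexpoint.
by case: t => [[|[|[|[|[|[|//]]]]]] ?]; rewrite !inE.
Qed.

Lemma hexpoint_inj t t' i j :
  i != j -> i \in hexpoint t -> j \in hexpoint t -> i \in hexpoint t' -> j \in hexpoint t' ->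
  t = t'.
Proof.
rewrite !inE => ij; have ij' : (i : nat) <> j by move=> e; case/eqP: ij; apply: val_inj.
have := divn_eq i 3; have := divn_eq j 3; have := ltn_ord t; have := ltn_ord t'.
move=> t6 t6' je ie it jt it' jt'; apply: val_inj => /=; move: it jt it' jt'.
case: ifP => t3; case: ifP => t3'; move=> /eqP e1 /eqP e2 /eqP e3 /eqP e4; lia.
Qed.

Lemma hex_triples : triples (concurrent a) setT = hexpoint @: setT.
Proof.
apply/setP => X; apply/idP/imsetP => [XT|[t _ ->]].
  have X3 : #|X| = 3%N by move: XT; rewrite inE => /and3P[_ /eqP].
  have /set0Pn[i iX] : X != set0 by rewrite -cards_eq0 X3.
  have [j [k [XE _ [ij ik jk]]]] := tripleP XT iX.
  rewrite hex_concurrentE // /hex_concurrent !val_eqE.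
  rewrite (negPf ij) (negPf ik) (negPf jk) /= => /orP[]/andP[/eqP e1 /eqP e2].
    have t6 : (i %% 3 < 6)%N by rewrite (@ltn_trans 3) ?ltn_mod.
    exists (Ordinal t6); rewrite // ; apply/eqP; rewrite eqEcard card_hexpoint X3 andbT.
    apply/subsetP => l; rewrite XE !inE /= ltn_mod -orbA.
    by case/or3P => /eqP ->; rewrite -?e2 -?e1 /= eqxx.
  have t6 : (i %/ 3 + 3 < 6)%N by move: (ltn_ord i); lia.
  exists (Ordinal t6); rewrite // ; apply/eqP; rewrite eqEcard card_hexpoint X3 andbT.
  apply/subsetP => l; rewrite XE !inE /= addnK ltnNge leq_addl /= -orbA.
  by case/or3P => /eqP ->; rewrite -?e2 -?e1 /= eqxx.
rewrite inE subsetT card_hexpoint eqxx /=.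
apply/forall_inP => i iX; apply/forall_inP => j jX; apply/forall_inP => k kX.
rewrite hex_concurrentE //; move: iX jX kX; rewrite !inE /hex_concurrent.
by case: ifP => _ /eqP -> /eqP -> /eqP ->; rewrite eqxx ?orbT.
Qed.

Lemma hex_linear : linear_triples (concurrent a).
Proof.
move=> X Y i j; rewrite hex_triples => /imsetP[t _ ->] /imsetP[t' _ ->] ij it jt it' jt'.
by rewrite (hexpoint_inj ij it jt it' jt').
Qed.

Lemma hex_card_triples : #|triples (concurrent a) setT| = 6%N.
Proof.
rewrite hex_triples card_imset ?cardsT ?card_ord // => t t' e.
have /card_gt1P[i [j [it jt ij]]] : (1 < #|hexpoint t|)%N by rewrite card_hexpoint.
by apply: (hexpoint_inj ij it jt); rewrite -e.
Qed.

Lemma hex_double_point : double_point a ord0 (inord 4).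
Proof.
split; first by rewrite -val_eqE /= inordK.
move=> k; rewrite hex_concurrentE // /hex_concurrent inordK //= => h.
have k9 := ltn_ord k.
have : (k == 0 :> nat) || (k == 4 :> nat).
  by move: h; case: (k : nat) k9 => [|[|[|[|[|[|[|[|[|//]]]]]]]]].
by case/orP => /eqP e; [left|right]; apply: val_inj; rewrite /= ?inordK.
Qed.

End GenericTriples.

End Hexagon.

(** * Six points on a conic *)

(** If b and w are not proportional, then v is along e_s, the only direction
    orthogonal to both. *)
Lemma vanishing_normal (K : fieldType) (s : 'I_3) (b w v : 'rV[K]_3) :
  b 0 s = 0 -> w 0 s = 0 -> dot b v = 0 -> dot v w = 0 ->
  ((forall j, j != s -> v 0 j = 0) -> w = 0) -> cross w b = 0.
Proof.
move=> bs ws bv vw h; apply/eqP; apply: contraT => c0.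
rewrite dotC in vw; have [x vE] := dot2_eq0P c0 vw bv.
case/eqP: c0; rewrite h ?cross0l // => j js; rewrite vE mxE.
suff -> : cross w b 0 j = 0 by rewrite mulr0.
move: j s js bs ws {h}; apply: ord3P; apply: ord3P => // _ bs ws;
  by rewrite crossE bs ws ?(mul0r, mulr0) ?subrr.
Qed.

Section ConicHexagon.

Variable K : fieldType.
Hypothesis charK : [pchar K] =i pred0.

Let a : 'I_9 -> 'rV[K]_3 := hexfamily K conic_table.

Let X : {mpoly K[3]} := 'X_0.
Let Y : {mpoly K[3]} := 'X_1.
Let Z : {mpoly K[3]} := 'X_2.

(* [F0], [F1] and [F2] are the products of the lines through e_0, e_1 and e_2. *)
Let F0 := linform (a (inord 0)) * linform (a (inord 3)) * linform (a (inord 6)).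
Let F1 := linform (a (inord 1)) * linform (a (inord 4)) * linform (a (inord 7)).
Let F2 := linform (a (inord 2)) * linform (a (inord 5)) * linform (a (inord 8)).

(* A solution, in cubic polynomials, of the linear system
   X F0 G0 + Y F1 G1 + Z F2 G2 = 0. *)
Let G0 := 3 *: (Y * Z * Z) + 2 *: (Y * Y * Z) + 4 *: (X * Y * Z)
  - X * X * Z - X * X * Y - X * X * X.
Let G1 := 3 *: (X * Z * Z) + 2 *: (X * Y * Z) - 2 *: (X * Y * Y)
  - 2 *: (Y * Y * Z) - 2 *: (Y * Y * Y) + X * X * Z.
Let G2 := 2 *: (X * Y * Y) + X * X * Y
  - 3 *: (X * Z * Z) - 3 *: (Y * Z * Z) - 3 *: (Z * Z * Z).

(** For a plane through e_s, being normal along it means that the component of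
    index s vanishes, except on the line e_s, where the other components must
    vanish as well. *)
Definition conic_form : 'rV[{mpoly K[3]}]_3 :=
  \row_j if j == 0 then F0 * G0 else if j == 1 then F1 * G1 else F2 * G2.

Lemma hex_dotE i (v : 'rV[K]_3) : (i < 9)%N -> dot (a (inord i)) v =
  (hexline conic_table i 0)%:~R * v 0 0 + (hexline conic_table i 1)%:~R * v 0 1
  + (hexline conic_table i 2)%:~R * v 0 2.
Proof. by move=> i9; rewrite dotE !mxE inordK. Qed.

Lemma conic_form_eval (v : 'rV[K]_3) : let x := v 0 0 in let y := v 0 1 in let z := v 0 2 in
  [/\ evalvec conic_form v 0 0 =
      ((-4 * y - 3 * z) * (y + 2 * z) * (- y + z)) *
      (3 * y * z ^+ 2 + 2 * y ^+ 2 * z + 4 * x * y * z - x ^+ 2 * z - x ^+ 2 * y - x ^+ 3),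
      evalvec conic_form v 0 1 =
      ((3 * z - x) * (- 2 * z - x) * (- z - 2 * x)) *
      (3 * x * z ^+ 2 + 2 * x * y * z - 2 * x * y ^+ 2 - 2 * y ^+ 2 * z - 2 * y ^+ 3 + x ^+ 2 * z)
    & evalvec conic_form v 0 2 =
      ((x + 4 * y) * (x - y) * (2 * x + y)) *
      (2 * x * y ^+ 2 + x ^+ 2 * y - 3 * x * z ^+ 2 - 3 * y * z ^+ 2 - 3 * z ^+ 3)].
Proof.
move=> x y z; split; rewrite !mxE /= !(mevalM, mevalB, mevalD, mevalZ, mevalXU) !meval_linform;
  rewrite !hex_dotE // /hexline /=; rewrite /conic_table /table /=.
all: rewrite /x /y /z !(mulrNz, opprK); ring.
Qed.


Lemma conic_form_homog l : conic_form 0 l \is 6.-homog.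
Proof.
have lin3 i j k : linform (a i) * linform (a j) * linform (a k) \is (1 + 1 + 1).-homog.
  by apply: dhomogM; [apply: dhomogM|]; apply: linform_homog.
have mon (i j k : 'I_3) : 'X_i * 'X_j * 'X_k \is [in K[3], (1 + 1 + 1).-homog].
  by apply: dhomogM; [apply: dhomogM|]; rewrite dhomogX /= mdeg1.
have hG0 : G0 \is (1 + 1 + 1).-homog by do ![apply: mon|apply: rpredZ|apply: rpredB|apply: rpredD].
have hG1 : G1 \is (1 + 1 + 1).-homog by do ![apply: mon|apply: rpredZ|apply: rpredB|apply: rpredD].
have hG2 : G2 \is (1 + 1 + 1).-homog by do ![apply: mon|apply: rpredZ|apply: rpredB|apply: rpredD].
rewrite mxE; case: ifP => _; first exact: (dhomogM (lin3 _ _ _) hG0).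
case: ifP => _; first exact: (dhomogM (lin3 _ _ _) hG1).
exact: (dhomogM (lin3 _ _ _) hG2).
Qed.

Lemma conic_form_closed : dot (varvec K) conic_form = 0.
Proof.
apply: (mpoly_vanish_eq0 charK) => v; rewrite meval_dot evalvec_var dotE.
have [-> -> ->] := conic_form_eval v; ring.
Qed.

Lemma conic_form_neq0 : conic_form != 0.
Proof.
apply/eqP => w0; pose v : 'rV[K]_3 := \row_j (j != 2)%:R.
have [e _ _] := conic_form_eval v; move: e; rewrite w0 !mxE /= meval0 => /eqP.
rewrite (_ : _ * _ = - 8%:R); last by ring.
by rewrite eq_sym oppr_eq0 (negPf (natr_neq0 charK 7)).
Qed.

Lemma conic_form_normal i : normal_along (a i) conic_form.
Proof.
have key (s : 'I_3) (k : nat) : (k < 9)%N -> (k %% 3 = s)%N ->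
    (forall v, dot (a (inord k)) v = 0 -> evalvec conic_form v 0 s = 0) ->
    normal_along (a (inord k)) conic_form.
  move=> k9 ks hs v kv; apply: (@vanishing_normal _ s _ _ v _ _ kv).
  - rewrite mxE inordK // /hexline -ks.
    have -> : (k %% 3 == (k + 1) %% 3)%N = false by lia.
    by have -> : (k %% 3 == (k + 2) %% 3)%N = false by lia.
  - exact: hs.
  - by rewrite -{1}(evalvec_var v) -meval_dot conic_form_closed meval0.
  move=> v0; have [e0 e1 e2] := conic_form_eval v.
  move: s v0 {ks hs}; apply: ord3P => v0;
    [have z1 := v0 1 isT; have z2 := v0 2 isT | have z1 := v0 0 isT; have z2 := v0 2 isT
    | have z1 := v0 0 isT; have z2 := v0 1 isT];
    by apply: row3P; rewrite ?e0 ?e1 ?e2 mxE z1 z2; ring.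
have F0v v k : dot (a (inord k)) v = 0 -> k \in [:: 0; 3; 6]%N -> evalvec conic_form v 0 0 = 0.
  move=> kv; rewrite !inE => /or3P[]/eqP e; subst k;
    by rewrite !mxE /= !mevalM !meval_linform kv ?(mul0r, mulr0).
have F1v v k : dot (a (inord k)) v = 0 -> k \in [:: 1; 4; 7]%N -> evalvec conic_form v 0 1 = 0.
  move=> kv; rewrite !inE => /or3P[]/eqP e; subst k;
    by rewrite !mxE /= !mevalM !meval_linform kv ?(mul0r, mulr0).
have F2v v k : dot (a (inord k)) v = 0 -> k \in [:: 2; 5; 8]%N -> evalvec conic_form v 0 2 = 0.
  move=> kv; rewrite !inE => /or3P[]/eqP e; subst k;
    by rewrite !mxE /= !mevalM !meval_linform kv ?(mul0r, mulr0).
rewrite -(inord_val i); case: i => k k9; rewrite /=.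
have : (k %% 3 < 3)%N by rewrite ltn_mod.
case e: (k %% 3)%N => [|[|[|//]]] _.
- apply: (key 0) => // v kv; apply: (F0v v k) => //.
  by rewrite !inE; lia.
- apply: (key 1) => // v kv; apply: (F1v v k) => //.
  by rewrite !inE; lia.
- apply: (key 2) => // v kv; apply: (F2v v k) => //.
  by rewrite !inE; lia.
Qed.

Lemma conic_has_log_form : has_log_form a setT 6.
Proof.
exists conic_form; last exact: conic_form_neq0.
by split=> *; [exact: conic_form_homog|exact: conic_form_closed|exact: conic_form_normal].
Qed.

End ConicHexagon.

(** * Six points off a conic *)

(** Reading r and s modulo 3 makes the configuration cyclic. *)
Definition hexindex (r s : nat) : nat := (3 * (r %% 3) + s %% 3)%N.

Lemma hexindexE i : (i < 9)%N -> (i %/ 3 < 3)%N /\ hexindex (i %/ 3) (i %% 3) = i.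
Proof. by move=> i9; rewrite /hexindex; lia. Qed.

(** The lines through neither e_s nor Q_r. *)
Definition hexothers (r s : nat) : seq nat :=
  [:: hexindex (r + 1) (s + 1); hexindex (r + 1) (s + 2);
      hexindex (r + 2) (s + 1); hexindex (r + 2) (s + 2)].

(** Lines meeting the line e_s Q_r in distinct points: one through e_s, one
    through Q_r, and those that meet it elsewhere. *)
Definition hexcrossing (r s : nat) : seq nat :=
  [:: hexindex (r + 1) s, hexindex r (s + 1) & hexothers r s].

(** The product of the other lines at the point p, as it enters in the relation
    between the scalars at e_s and Q_r. *)
Definition holonomy u r s (p : nat -> int) : int :=
  foldr (fun k x => zdot (hexline u k) p * x) 1 (hexothers r s).

(** Going around the quadrilateral e_0 Q_0 e_1 Q_1 multiplies the scalar at e_0 by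
    the ratio of these two products. *)
Definition holonomy_gap u : int :=
  holonomy u 0 0 (invpoint u 0) * holonomy u 0 1 (coordpoint 1)
  * (holonomy u 1 1 (invpoint u 1) * holonomy u 1 0 (coordpoint 0))
  - holonomy u 0 0 (coordpoint 0) * holonomy u 0 1 (invpoint u 0)
  * (holonomy u 1 1 (coordpoint 1) * holonomy u 1 0 (invpoint u 1)).

Definition all3 (p : nat -> nat -> bool) :=
  all (fun r => all (p r) (iota 0 3)) (iota 0 3).

Lemma all3P p r s : all3 p -> (r < 3)%N -> (s < 3)%N -> p r s.
Proof.
move=> /allP h r3 s3; have r9 : r \in iota 0 3 by rewrite mem_iota.
by have /allP := h r r9; apply; rewrite mem_iota.
Qed.

Definition hex_points_generic u :=
  all3 (fun r s => [&&
    zdot (hexline u (hexindex r s)) (coordpoint s) == 0,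
    zdot (hexline u (hexindex r s)) (invpoint u r) == 0,
    znonzero (zcross (coordpoint s) (invpoint u r)),
    (r != s) ==> all (fun t => zdet (coordpoint t) (invpoint u r) (invpoint u s) != 0) (iota 0 3)
    & (r != s) ==> all (fun t => zdet (invpoint u t) (coordpoint r) (coordpoint s) != 0)
                      (iota 0 3)]).

Lemma nonconic_points_generic : hex_points_generic nonconic_table.
Proof. by vm_cast_no_check (erefl true). Qed.

Lemma nonconic_holonomy_gap : holonomy_gap nonconic_table != 0.
Proof. by vm_cast_no_check (erefl true). Qed.

Section NoForm.

Variable K : fieldType.
Hypothesis charK : [pchar K] =i pred0.
Variable u : nat -> nat -> int.
Hypotheses (gen : hex_generic u) (pts : hex_points_generic u).
Hypothesis gap : holonomy_gap u != 0.

Let a : 'I_9 -> 'rV[K]_3 := hexfamily K u.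
Let e (s : nat) : 'rV[K]_3 := zrow K (coordpoint s).
Let Q (r : nat) : 'rV[K]_3 := zrow K (invpoint u r).
Let L (r s : nat) : 'rV[K]_3 := a (inord (hexindex r s)).

Variable w : 'rV[{mpoly K[3]}]_3.
Hypothesis hw : log_form a setT 6 w.

Lemma hexindex_lt r s : (hexindex r s < 9)%N.
Proof. by rewrite /hexindex; have := ltn_pmod r (isT : 0 < 3)%N;
  have := ltn_pmod s (isT : 0 < 3)%N; lia. Qed.

Lemma zrow_hexline k : (k < 9)%N -> a (inord k) = zrow K (hexline u k).
Proof. by move=> k9; rewrite /a /hexfamily inordK. Qed.

Lemma hex_normal i : normal_along (a i) w.
Proof. by case: hw => _ _; apply. Qed.

Lemma L_points r s : (r < 3)%N -> (s < 3)%N ->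
  [/\ dot (L r s) (e s) = 0, dot (L r s) (Q r) = 0 & cross (e s) (Q r) != 0].
Proof.
move=> r3 s3; have /and5P[/eqP h1 /eqP h2 h3 _ _] := all3P pts r3 s3.
rewrite /L zrow_hexline ?hexindex_lt // !dot_zrow h1 h2 cross_zrow; split=> //.
exact: zrow_neq0.
Qed.

Lemma det3_eQQ t r r' : (t < 3)%N -> (r < 3)%N -> (r' < 3)%N -> r != r' ->
  det3 (e t) (Q r) (Q r') != 0.
Proof.
move=> t3 r3 r3' rr; rewrite det3_zrow intr_char0_eq0 //.
have /and5P[_ _ _ /implyP/(_ rr)/allP h _] := all3P pts r3 r3'.
by apply: h; rewrite mem_iota.
Qed.

Lemma det3_Qee t s s' : (t < 3)%N -> (s < 3)%N -> (s' < 3)%N -> s != s' ->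
  det3 (Q t) (e s) (e s') != 0.
Proof.
move=> t3 s3 s3' ss; rewrite det3_zrow intr_char0_eq0 //.
have /and5P[_ _ _ _ /implyP/(_ ss)/allP h] := all3P pts s3 s3'.
by apply: h; rewrite mem_iota.
Qed.

(** For v in the plane of b, the function v . w vanishes on that plane, and
    so does its derivative along it. *)
Lemma normal_derivative (b P v : 'rV[K]_3) : b != 0 -> normal_along b w ->
  dot b P = 0 -> dot b v = 0 -> dot v (dirderiv_vec w P v) = 0.
Proof.
move=> b0 nb bP bv; pose p := dot (cstvec v) w.
have -> : dot v (dirderiv_vec w P v) = dirderiv p P v.
  rewrite /p !dotE !dirderivD !mxE !mul_mpolyC !dirderivZ //.
apply: (dirderiv_vanish charK b0) => // x bx.
rewrite meval_dot evalvec_cst; have [->|u0] := eqVneq (evalvec w x) 0; first exact: dot0r.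
have [z bE] := cross_eq0P u0 (nb x bx); move: bv; rewrite bE dotZl dotC => /eqP.
rewrite mulf_eq0 => /orP[/eqP z0|/eqP //].
by case/eqP: b0; rewrite bE z0 scale0r.
Qed.

Lemma L_neq0 r s : L r s != 0.
Proof. exact: (hex_indep charK gen).1. Qed.

Lemma cross_L r s r' s' : hexindex r s != hexindex r' s' -> cross (L r s) (L r' s') != 0.
Proof.
move=> h; apply: (hex_indep charK gen).2.
by apply: contraNneq h => /(congr1 val); rewrite /= !inordK ?hexindex_lt // => ->.
Qed.

Lemma derivative_e s : (s < 3)%N ->
  exists q : K, forall v, dirderiv_vec w (e s) v = q *: cross (e s) v.
Proof.
move=> s3; have [hh xw _] := hw.
have [p0 q0 _] := L_points (r := 0%N) isT s3; have [p1 q1 _] := L_points (r := 1%N) isT s3.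
have [p2 q2 _] := L_points (r := 2%N) isT s3.
apply: (triple_point_derivative (m := 6) (v1 := Q 0%N) (v2 := Q 1%N) (v3 := Q 2%N)) => //.
- apply: (normal_two_planes (f := L 0%N s) (g := L 1%N s)) => //; try exact: hex_normal.
  by apply: cross_L; rewrite /hexindex; lia.
- exact: det3_eQQ.
- exact: det3_eQQ.
- exact: det3_eQQ.
- by apply: (normal_derivative (L_neq0 0 s)) => //; apply: hex_normal.
- by apply: (normal_derivative (L_neq0 1 s)) => //; apply: hex_normal.
- by apply: (normal_derivative (L_neq0 2 s)) => //; apply: hex_normal.
Qed.

Lemma derivative_Q r : (r < 3)%N ->
  exists q : K, forall v, dirderiv_vec w (Q r) v = q *: cross (Q r) v.
Proof.
move=> r3; have [hh xw _] := hw.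
have [p0 q0 _] := L_points (s := 0%N) r3 isT; have [p1 q1 _] := L_points (s := 1%N) r3 isT.
have [p2 q2 _] := L_points (s := 2%N) r3 isT.
apply: (triple_point_derivative (m := 6) (v1 := e 0%N) (v2 := e 1%N) (v3 := e 2%N)) => //.
- apply: (normal_two_planes (f := L r 0%N) (g := L r 1%N)) => //; try exact: hex_normal.
  by apply: cross_L; rewrite /hexindex; lia.
- exact: det3_Qee.
- exact: det3_Qee.
- exact: det3_Qee.
- by apply: (normal_derivative (L_neq0 r 0%N)) => //; apply: hex_normal.
- by apply: (normal_derivative (L_neq0 r 1%N)) => //; apply: hex_normal.
- by apply: (normal_derivative (L_neq0 r 2%N)) => //; apply: hex_normal.
Qed.

Lemma hexcrossing_generic :
  all3 (fun r s =>
    all (fun k => (k < 9)%N && (hexindex r s != k)) (hexcrossing r s) &&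
    pairwise (fun k l => ~~ hex_concurrent (hexindex r s) k l) (hexcrossing r s)).
Proof. by []. Qed.

Lemma holonomyE r s (p : nat -> int) :
  \prod_(g <- [seq a (inord k) | k <- hexothers r s]) dot g (zrow K p)
  = (holonomy u r s p)%:~R.
Proof.
rewrite /holonomy big_map.
have : all (fun k => k < 9)%N (hexothers r s) by rewrite /= !hexindex_lt.
elim: (hexothers r s) => [_|k l ih /= /andP[k9 /ih e']]; first by rewrite big_nil.
by rewrite big_cons e' zrow_hexline // dot_zrow rmorphM.
Qed.

(** Going around the quadrilateral multiplies the scalar at e_0 by a ratio that
    differs from 1, so that this scalar is zero; hence those at the Q_r are zero,
    and the form vanishes on all nine planes, too many for its degree. *)
Lemma hex_no_form : w = 0.
Proof.
have [hh xw _] := hw.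
have /choice[qe hqe] : forall s, exists q : K, (s < 3)%N ->
    forall v, dirderiv_vec w (e s) v = q *: cross (e s) v.
  by move=> s; have [/derivative_e[q hq]|_] := ltnP s 3; [exists q|exists 0].
have /choice[qQ hqQ] : forall r, exists q : K, (r < 3)%N ->
    forall v, dirderiv_vec w (Q r) v = q *: cross (Q r) v.
  by move=> r; have [/derivative_Q[q hq]|_] := ltnP r 3; [exists q|exists 0].
have edge r s : (r < 3)%N -> (s < 3)%N ->
    [/\ (holonomy u r s (coordpoint s))%:~R != 0 :> K,
        (holonomy u r s (invpoint u r))%:~R != 0 :> K,
        qe s * (holonomy u r s (invpoint u r))%:~R
        = - (qQ r * (holonomy u r s (coordpoint s))%:~R) &
        qQ r = 0 -> forall l, vanishes_on (L r s) (w 0 l)].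
  move=> r3 s3; have [ps qr c] := L_points r3 s3.
  have /andP[/allP crs prs] := all3P hexcrossing_generic r3 s3.
  rewrite -!holonomyE.
  have l3 k : (k %% 3 < 3)%N by rewrite ltn_mod.
  have [f1 _ _] := L_points (r := ((r + 1) %% 3)%N) (l3 _) s3.
  have [_ f2 _] := L_points (s := ((s + 1) %% 3)%N) r3 (l3 _).
  have m1 : L ((r + 1) %% 3)%N s = L (r + 1)%N s by rewrite /L /hexindex modn_mod.
  have m2 : L r ((s + 1) %% 3)%N = L r (s + 1)%N by rewrite /L /hexindex modn_mod.
  rewrite m1 in f1; rewrite m2 in f2.
  have cat : [:: L (r + 1)%N s, L r (s + 1)%N & [seq a (inord k) | k <- hexothers r s]]
      = [seq a (inord k) | k <- hexcrossing r s] by [].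
  have [] := @edge_relation K charK (L r s) (L (r + 1)%N s) (L r (s + 1)%N)
    [seq a (inord k) | k <- hexothers r s] w 6 (e s) (Q r) (qe s) (qQ r)
    hh erefl isT (L_neq0 r s) (@hex_normal (inord (hexindex r s))) _ _ _ ps f1 qr f2 c (hqe s s3) (hqQ r r3).
  - by rewrite cat => g /mapP[k _ ->]; apply: hex_normal.
  - rewrite cat => g /mapP[k kc ->]; have /andP[k9 nk] := crs k kc.
    apply: (hex_indep charK gen).2; apply: contraNneq nk => /(congr1 val).
    by rewrite /= !inordK ?hexindex_lt // => ->.
  - rewrite cat pairwise_map; move: prs; apply: (@sub_in_pairwise _ (mem (hexcrossing r s))).
      move=> k l kc lc; have /andP[k9 _] := crs k kc; have /andP[l9 _] := crs l lc.
      rewrite /= -[det3 _ _ _ == 0]/(concurrent a _ _ _) hex_concurrentE //.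
      by rewrite !inordK ?hexindex_lt.
    exact/allP.
  by move=> h1 h2 h3 _ h5; split.
have [d00 b00 r00 v00] := edge 0%N 0%N isT isT; have [d01 b01 r01 _] := edge 0%N 1%N isT isT.
have [d10 b10 r10 _] := edge 1%N 0%N isT isT; have [d11 b11 r11 _] := edge 1%N 1%N isT isT.
have qe0 : qe 0%N = 0.
  have : qe 0%N * (holonomy_gap u)%:~R = 0 :> K.
    move: r00 r01 r10 r11; rewrite /holonomy_gap; clear.
    move: (holonomy u 0 0 (invpoint u 0)) (holonomy u 0 0 (coordpoint 0)) => A A'.
    move: (holonomy u 0 1 (coordpoint 1)) (holonomy u 0 1 (invpoint u 0)) => B B'.
    move: (holonomy u 1 1 (invpoint u 1)) (holonomy u 1 1 (coordpoint 1)) => C C'.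
    move: (holonomy u 1 0 (coordpoint 0)) (holonomy u 1 0 (invpoint u 1)) => D D'.
    rewrite rmorphB !rmorphM /=.
    move: A%:~R B%:~R C%:~R D%:~R A'%:~R B'%:~R C'%:~R D'%:~R => {}A {}B {}C {}D {}A' {}B' {}C' {}D'.
    move=> r00 r01 r10 r11.
    transitivity ((qe 0%N * A) * (B * C * D) - (qe 0%N * D') * (A' * B' * C')); first by ring.
    rewrite r00 r10.
    transitivity (- (qQ 0%N * B) * (A' * C * D) - - (qQ 1%N * C') * (D * A' * B')).
      by ring.
    by rewrite -r01 -r11; ring.
  by move/eqP; rewrite mulf_eq0 intr_char0_eq0 // (negPf gap) orbF => /eqP.
have van r s l : (r < 3)%N -> (s < 3)%N -> vanishes_on (L r s) (w 0 l).
  move=> r3 s3; have [_ _ _] := edge r s r3 s3; apply.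
  have [d _ + _] := edge r 0%N r3 isT; rewrite qe0 mul0r => /esym/eqP.
  by rewrite oppr_eq0 mulf_eq0 (negPf d) orbF => /eqP.
apply/rowP => l; rewrite mxE; apply/eqP; apply: contraT => wl.
have [q wq] : exists q, w 0 l = plane_product a * q.
  apply: (planes_divide charK (hex_indep charK gen)) => [|i _].
    exact: index_enum_uniq.
  rewrite -/(a i); have -> : a i = L (i %/ 3)%N (i %% 3)%N.
    by rewrite /L (hexindexE (ltn_ord i)).2 inord_val.
  by apply: van; [case: (hexindexE (ltn_ord i))|rewrite ltn_mod].
have q0 : q != 0 by apply: contraNneq wl => q0; rewrite wq q0 mulr0.
have := hh l; rewrite wq => hl.
have := dhomog_cancel (plane_product_neq0 (hex_indep charK gen))
  (plane_product_homog a) hl q0.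
by rewrite card_ord => -[].
Qed.

End NoForm.

(** * Pairs with the same lattice and different syzygies *)

Lemma hexagon_twins (K : fieldType) (charK : [pchar K] =i pred0) : lattice_twins K 9 6.
Proof.
exists (hexfamily K nonconic_table), (hexfamily K conic_table), ord0, (inord 4); split.
- by split; [exact: (hex_indep charK nonconic_generic)|exact: (hex_indep charK conic_generic)].
- exact: (hex_concurrent_eq charK nonconic_generic conic_generic).
- by split; [exact: (hex_linear charK nonconic_generic)|exact: (hex_card_triples charK nonconic_generic)].
- exact: (hex_double_point charK nonconic_generic).
split; last exact: conic_has_log_form.
case=> w hw /eqP[]; exact: (hex_no_form charK nonconic_generic nonconic_points_generic nonconic_holonomy_gap hw).
Qed.

Lemma lattice_twins_ge6 (K : fieldType) (charK : [pchar K] =i pred0) k :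
  lattice_twins K (9 + k) (6 + k).
Proof.
elim: k => [|k ih]; first exact: hexagon_twins.
by rewrite !addnS; apply: (lattice_twinsS charK) ih.
Qed.

Theorem corollary4p20 (K : fieldType) (charK : [pchar K] =i pred0) (n3 : nat) :
  (forall A1 A2 : line_arrangement K,
      (2 <= nlines A1)%N -> (2 <= nlines A2)%N ->
      only_double_triple_points A1 -> only_double_triple_points A2 ->
      has_npoints A1 3 n3 -> has_npoints A2 3 n3 ->
      lattice_isomorphic A1 A2 ->
      mdr A1 = mdr A2)
  <-> (n3 <= 5)%N.
Proof.
split=> [h|n5 A1 A2 l1 l2 d1 d2 t1 t2 iso]; last first.
  exact: (mdr_combinatorial charK l1 l2 d1 d2 t1 t2 n5 iso).
rewrite leqNgt; apply/negP => n6.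
have := lattice_twins_ge6 charK (n3 - 6); rewrite subnKC // => tw.
have [//|A1 [A2 [[l1 l2] [d1 d2] [t1 t2] iso []]]] := lattice_twins_mdr charK _ tw.
exact: h.
Qed.
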